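(* Let $K\in\mathcal{K}^2$. Then $$\frac{\mathrm{A}(K)}{\mathrm{D}_B(K)^2}\leq 2\arctan\left(\frac{3}{4}\right),$$ with equality if and only if $K$ coincides, up to dilations and rigid motions, with the set $$Q=\left\{(x_1,x_2)\in\mathbb{R}^2:\ -\tfrac{1}{\sqrt5}\leq x_1\leq \tfrac{1}{\sqrt5},\ \left(x_1+\tfrac{1}{\sqrt5}\right)^2+x_2^2\leq 1,\ \left(x_1-\tfrac{1}{\sqrt5}\right)^2+x_2^2\leq 1\right\}.$$
   Context: $\mathcal{K}^2$ is the family of planar convex bodies (compact convex subsets of $\mathbb{R}^2$) with non-empty interior. For a compact set $S\subset\mathbb{R}^2$, $\mathrm{A}(S)$ is its area (2-dimensional Lebesgue measure) and $\mathrm{D}(S)$ its diameter (largest Euclidean distance between two points of $S$). A bisection of $K\in\mathcal{K}^2$ is a pair of closed sets $(K_1,K_2)$ such that (i) $K=K_1\cup K_2$, and (ii) $K_1\cap K_2=l([-1,1])$, where $l:[-1,1]\to K$ is an injective continuous curve whose endpoints $l(-1),l(1)$ are the only points of the curve lying in the boundary of $K$. $\mathcal{B}(K)$ is the set of all bisections of $K$, and $\mathrm{D}_B(K)=\inf_{(K_1,K_2)\in\mathcal{B}(K)}\max\{\mathrm{D}(K_1),\mathrm{D}(K_2)\}$. *)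

(* Defs.v *)
From HB Require Import structures.
From mathcomp Require Import all_boot all_order all_algebra.
From mathcomp Require Import all_classical all_reals all_analysis.

Set Implicit Arguments.
Unset Strict Implicit.
Unset Printing Implicit Defensive.

Import Order.TTheory GRing.Theory Num.Theory.
Import numFieldNormedType.Exports.

Local Open Scope classical_set_scope.
Local Open Scope ring_scope.

(* The norm [`|p|] that the library puts on [R * R] is the max norm, so the
   Euclidean distance is introduced by hand; both induce the same topology. *)
Definition edist (R : realType) (p q : R * R) : R :=
  Num.sqrt ((p.1 - q.1) ^+ 2 + (p.2 - q.2) ^+ 2).

Definition convex_body (R : realType) (K : set (R * R)) : Prop :=
  [/\ compact K, convex_set K & interior K !=set0].

(* [fine] sends infinite measure to 0; compact sets have finite measure. *)
Definition area (R : realType) (S : set (R * R)) : R :=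
  fine ((@lebesgue_measure R \x @lebesgue_measure R)%E S).

(* On a nonempty compact set this supremum is a maximum. *)
Definition diam (R : realType) (S : set (R * R)) : R :=
  sup [set edist p q | p in S & q in S].

Definition boundary (R : realType) (S : set (R * R)) : set (R * R) :=
  closure S `\` interior S.

(* The curve is a total function [R -> R * R] of which only the restriction to
   [-1, 1] matters. *)
Definition dividing_curve (R : realType) (K : set (R * R)) (l : R -> R * R) :
    Prop :=
  [/\ {within `[(-1 : R), 1], continuous l},
      set_inj `[(-1 : R), 1] l,
      l @` `[(-1 : R), 1] `<=` K &
      (l @` `[(-1 : R), 1]) `&` boundary K = [set l (-1); l 1]].

Definition bisection (R : realType) (K : set (R * R)) :
    set (set (R * R) * set (R * R)) :=
  [set B | [/\ closed B.1, closed B.2, K = B.1 `|` B.2 &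
     exists l : R -> R * R,
       dividing_curve K l /\ B.1 `&` B.2 = l @` `[(-1 : R), 1]]].

(* [inf] is the genuine infimum here: the values are bounded below by 0, and a
   convex body has a bisection. *)
Definition DB (R : realType) (K : set (R * R)) : R :=
  inf [set Num.max (diam B.1) (diam B.2) | B in bisection K].

Definition rigid_motion (R : realType) (f : R * R -> R * R) : Prop :=
  forall p q, edist (f p) (f q) = edist p q.

Definition dilation (R : realType) (c : R) (p : R * R) : R * R :=
  (c * p.1, c * p.2).

Definition coincide_up_to_dilation_and_rigid_motion (R : realType)
    (K L : set (R * R)) : Prop :=
  exists (c : R) (f : R * R -> R * R),
    [/\ 0 < c, rigid_motion f & K = f @` (dilation c @` L)].

Definition Qset (R : realType) : set (R * R) :=
  [set x | [/\ - (1 / Num.sqrt 5) <= x.1 <= 1 / Num.sqrt 5,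
     (x.1 + 1 / Num.sqrt 5) ^+ 2 + x.2 ^+ 2 <= 1 &
     (x.1 - 1 / Num.sqrt 5) ^+ 2 + x.2 ^+ 2 <= 1]].

Arguments Qset R : clear implicits.

(* Main.v *)
Require Import Defs.
From HB Require Import structures.
From mathcomp Require Import all_boot all_order all_algebra.
From mathcomp Require Import all_classical all_reals all_analysis.
From mathcomp Require Import measurable_realfun ring lra.
Import Order.TTheory GRing.Theory Num.Theory.
Import numFieldNormedType.Exports.
Local Open Scope classical_set_scope.
Local Open Scope ring_scope.

(* A dividing curve with endpoints p and q does no better than the line pq: each
   open boundary arc cut off by that line is connected, hence contained in one of
   the two pieces, and the part of K on one side of the line lies in the convex
   hull of its arc. By compactness, some line therefore cuts K into two open parts
   of diameter at most D = D_B(K). Normalize so that D = 1, the line is y = 0 and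
   it meets K in [-a, a] x {0}. Let w(y) be the length of the slice of K at height
   y. All points of K are at distance at most 1 from (-a, 0) and (a, 0), so
   w(y) <= 2 (sqrt (1 - y^2) - a); midpoints of the slices at heights y and -y lie
   in the chord, so w(y) + w(-y) <= 4 a, or <= 1 if one of the slices is empty.
   Hence the area is at most 1 < 2 atan (3/4) if a <= 1/4, and at most
   4 int_a^(2a) sqrt (1 - x^2) dx otherwise; this integral is maximal exactly for
   a = 1 / sqrt 5, where it gives 2 atan (3/4). In the case of equality almost all
   slices have maximal width, so K contains the arcs of Q, which forces K = Q. *)

Set Implicit Arguments.
Unset Strict Implicit.
Unset Printing Implicit Defensive.

Local Notation edist := Defs.edist.
Local Notation mu := (@lebesgue_measure _).

(** * Planar Lebesgue measure under affine maps *)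

(** With s = sqrt (1 - y^2), averaging over y and -y bounds the area by the integral of 2 min (a, s
    - a)^+. The integrals of (s - a)^+ and (s - 2 a)^+ are areas of segments of the unit disc, cut
    off at distances a and 2 a from the center, and their difference is the band that appears in the
    bound. Its derivative in a vanishes when 4 (1 - 4 a^2) = 1 - a^2, that is a^2 = 1/5, and twice
    the band is then 2 (atan 2 - atan (1/2)) = 2 atan (3/4). The infimum in [DB] comes with no
    optimal curve, and curves have no compactness. Each bisection is therefore traded at once for a
    line, coded by a unit normal and an offset. Diameter bounds on the two open sides pass to limits
    of such lines, because lying strictly on one side is an open condition. Nothing is known at
    first about points on the limit line; they are reached by pushing them slightly towards a point
    off the line. *)

Definition mu2 {R : realType} : set (R * R) -> \bar R :=
  (@lebesgue_measure R \x @lebesgue_measure R)%E.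

(** The sigma-algebra on the plane is the product one, so open sets must come from rectangles. Balls
    of the max norm are squares, and those with rational center and radius contained in [U] are
    countably many and cover it. *)
Lemma open_measurable2 (R : realType) (U : set (R * R)) :
  open U -> measurable U.
Proof.
move=> oU.
pose D := [set q : rat * rat * rat |
  ball (ratr q.1.1 : R, ratr q.1.2 : R) (ratr q.2) `<=` U].
have -> : U = \bigcup_(q in D)
    (ball (ratr q.1.1 : R) (ratr q.2) `*` ball (ratr q.1.2 : R) (ratr q.2)).
  apply/seteqP; split => [[x y] Uxy|[x y] [[[q1 q2] r]] /= Dq [/= bx byy]]; last first.
    by apply: Dq => /=; split.
  have : nbhs (x, y) U by apply: open_nbhs_nbhs.
  move=> /nbhs_ballP[e /= e0 beU].
  have [r /andP[r0 re]] : exists r : rat, 0 < (ratr r : R) < e / 2.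
    have /rat_in_itvoo[r] : 0 < e / 2 by rewrite divr_gt0.
    by rewrite in_itv /=; exists r.
  have [q1 hq1] : exists q1 : rat, `|x - ratr q1| < ratr r.
    have /rat_in_itvoo[q] : x - ratr r < x + ratr r by lra.
    rewrite in_itv /= => /andP[h1 h2]; exists q; rewrite ltr_norml; lra.
  have [q2 hq2] : exists q1 : rat, `|y - ratr q1| < ratr r.
    have /rat_in_itvoo[q] : y - ratr r < y + ratr r by lra.
    rewrite in_itv /= => /andP[h1 h2]; exists q; rewrite ltr_norml; lra.
  exists (q1, q2, r); last by split; rewrite /= -ball_normE /= distrC.
  move=> [x' y'] [/=]; rewrite -!ball_normE /= => h1 h2.
  apply: beU; split; rewrite /= -ball_normE /=.
    have := ler_distD (ratr q1) x x'; lra.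
  have := ler_distD (ratr q2) y y'; lra.
rewrite bigcup_mkcond; apply: countable_bigcupT_measurable => [|q].
  exact: countableP.
case: ifPn => // _; apply: measurableX; apply: open_measurable; exact: ball_open.
Qed.

Lemma closed_measurable2 (R : realType) (F : set (R * R)) :
  closed F -> measurable F.
Proof.
move=> cF; rewrite -(setCK F); apply: measurableC.
by apply: open_measurable2; apply: closed_openC.
Qed.

Lemma measurable_affine (R : realType) (al be : R) :
  measurable_fun setT (fun x : R => al * x + be).
Proof.
apply: measurable_funD => //; exact: measurable_funM.
Qed.

(** [|al|] times the pushforward of Lebesgue measure gives half-open intervals their length, hence
    is Lebesgue measure. *)
Lemma lebesgue_measure_affine (R : realType) (al be : R) (A : set R) :
  al != 0 -> measurable A ->
  mu ((fun x => al * x + be) @^-1` A) = ((`|al|^-1)%:E * mu A)%E.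
Proof.
move=> al0 mA.
pose f x := al * x + be.
have mf : measurable_fun [set: measurableTypeR R] (f : measurableTypeR R ->
    measurableTypeR R).
  exact: measurable_affine.
have al1 : 0 < `|al| by rewrite normr_gt0.
pose nu : {measure set (measurableTypeR R) -> \bar R} :=
  mscale (NngNum (ltW al1)) (pushforward mu (f : measurableTypeR R -> measurableTypeR R)).
have -> : mu A = nu mf A; last first.
  rewrite /nu /mscale /= /pushforward muleA -EFinM mulVf ?mul1e//.
  by rewrite gt_eqF.
apply: lebesgue_measure_unique => //= _ [[a b]] _ <- /=.
rewrite /nu /mscale /= /pushforward.
have [alp|aln] : 0 < al \/ al < 0 by move/lt_total : al0 => /orP[]; [right|left].
  have -> : f @^-1` `]a, b] = `](a - be) / al, (b - be) / al]%classic.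
    apply/seteqP; split => x /=; rewrite !in_itv /= /f ltr_pdivrMr ?ler_pdivlMr//; lra.
  rewrite !lebesgue_measure_itv /= !lte_fin ltr_pM2r ?invr_gt0// ltrD2r.
  case: ifP => _; last by rewrite mule0.
  by rewrite -!EFinB -EFinM gtr0_norm//; congr EFin; field.
(* A decreasing map exchanges the open and the closed end; the length is the same. *)
have -> : f @^-1` `]a, b] = `[(b - be) / al, (a - be) / al[%classic.
  apply/seteqP; split => x /=; rewrite !in_itv /= /f ltr_ndivlMr ?ler_ndivrMr//; lra.
rewrite !lebesgue_measure_itv /= !lte_fin ltr_nM2r ?invr_lt0// ltrD2r.
case: ifP => _; last by rewrite mule0.
by rewrite -!EFinB -EFinM ltr0_norm//; congr EFin; field.
Qed.

Section area_transport.
Context {R : realType}.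
Implicit Types S : set (R * R).

(** The product measure is built from vertical sections; its uniqueness gives the formula by
    horizontal ones. *)
Lemma mu2E2 S : measurable S -> mu2 S = (\int[mu]_y mu (ysection S y))%E.
Proof.
move=> mS; rewrite /mu2.
have := @product_measure_unique _ _ _ _ R (@lebesgue_measure R) (@lebesgue_measure R)
  (@lebesgue_measure R \x^ @lebesgue_measure R)%E.
by move=> -> // A B mA mB; exact: product_measure2E.
Qed.

Lemma mu2_swap S : measurable S -> mu2 ((fun p => (p.2, p.1)) @^-1` S) = mu2 S.
Proof.
move=> mS; rewrite (mu2E2 mS) /mu2 /product_measure1; apply: eq_integral => y _ /=.
by congr (mu _); apply/seteqP; split => x; rewrite /xsection /ysection /= !inE.
Qed.

Lemma mu2_slice_affine S (al k t : R) : al != 0 -> measurable S ->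
  mu2 ((fun p => (al * p.1 + k * p.2 + t, p.2)) @^-1` S) = ((`|al|^-1)%:E * mu2 S)%E.
Proof.
move=> al0 mS; rewrite !mu2E2 //; last first.
  rewrite -[X in measurable X]setTI.
  have : measurable_fun setT (fun p : R * R => (al * p.1 + k * p.2 + t, p.2)).
    apply/measurable_fun_pairP; split.
      apply: measurable_funD => //; apply: measurable_funD; apply: measurable_funM => //.
    exact: measurable_snd.
  by move=> /(_ measurableT _ mS).
rewrite -ge0_integralZl//; last first.
  by apply: (measurable_fun_ysection (@lebesgue_measure R)).
apply: eq_integral => y _; rewrite -(@lebesgue_measure_affine _ _ (k * y + t))//.
  congr (mu _); apply/seteqP; split => x; rewrite /ysection /= !inE /=; rewrite addrA//.
exact: measurable_ysection.
Qed.

Definition affine (p q t1 r s t2 : R) (z : R * R) : R * R :=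
  (p * z.1 + q * z.2 + t1, r * z.1 + s * z.2 + t2).

Lemma measurable_preimage_affine S (p q t1 r s t2 : R) : measurable S ->
  measurable (affine p q t1 r s t2 @^-1` S).
Proof.
move=> mS; rewrite -[X in measurable X]setTI.
have : measurable_fun setT (affine p q t1 r s t2).
  by apply/measurable_fun_pairP; split;
     apply: measurable_funD => //; apply: measurable_funD; apply: measurable_funM.
by move=> /(_ measurableT _ mS).
Qed.

(* Shear and swap factorization of the linear part. *)
Lemma mu2_affine S (p q t1 r s t2 : R) : p * s - q * r != 0 -> measurable S ->
  mu2 (affine p q t1 r s t2 @^-1` S) = ((`|p * s - q * r|^-1)%:E * mu2 S)%E.
Proof.
move=> det0 mS.
have msw A : measurable A -> measurable ((fun z : R * R => (z.2, z.1)) @^-1` A).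
  move=> mA; have := @measurable_preimage_affine A 0 1 0 1 0 0 mA.
  congr (measurable _); apply/seteqP; split => -[x y]; rewrite /affine /=;
  by rewrite !(mul0r, mul1r, add0r, addr0).
have key (p' q' t1' r' s' t2' : R) : p' != 0 -> p' * s' - q' * r' != 0 ->
    mu2 (affine p' q' t1' r' s' t2' @^-1` S) = ((`|p' * s' - q' * r'|^-1)%:E * mu2 S)%E.
  (* [e] is the second pivot of Gaussian elimination, so the determinant is [p' * e]. *)
  move=> p0 d0; pose e := (p' * s' - q' * r') / p'.
  have e0 : e != 0 by rewrite mulf_neq0// invr_eq0.
  pose S1 := (fun z : R * R => (z.2, z.1)) @^-1` S.
  pose S2 := (fun z => (e * z.1 + r' / p' * z.2 + (t2' - r' * t1' / p'), z.2)) @^-1` S1.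
  pose S3 := (fun z : R * R => (z.2, z.1)) @^-1` S2.
  have mS1 : measurable S1 by exact: msw.
  have mS2 : measurable S2.
    have := @measurable_preimage_affine _ e (r' / p') (t2' - r' * t1' / p') 0 1 0 mS1.
    by congr (measurable _); apply/seteqP; split => -[x y]; rewrite /affine /=;
    rewrite !(mul0r, mul1r, add0r, addr0).
  have mS3 : measurable S3 by exact: msw.
  have -> : affine p' q' t1' r' s' t2' @^-1` S =
      (fun z => (p' * z.1 + q' * z.2 + t1', z.2)) @^-1` S3.
    have eE x y : e * y + r' / p' * (p' * x + q' * y + t1') + (t2' - r' * t1' / p') =
        r' * x + s' * y + t2' by rewrite /e; field.
    by apply/seteqP; split => -[x y]; rewrite /S3 /S2 /S1 /affine /= eE.
  rewrite mu2_slice_affine// mu2_swap// mu2_slice_affine// mu2_swap// muleA -EFinM.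
  by rewrite -invfM -normrM /e mulrC divfK.
have [p0|] := eqVneq p 0; last by move=> p0; exact: key.
have q0 : q != 0 by apply: contra_neq det0 => ->; rewrite p0; ring.
have -> : affine p q t1 r s t2 @^-1` S =
   (fun z : R * R => (z.2, z.1)) @^-1` (affine q p t1 s r t2 @^-1` S).
  apply/seteqP; split => -[x y]; rewrite /affine /=;
  by rewrite (addrC (p * x)) (addrC (r * x)).
rewrite mu2_swap ?key//; last exact: measurable_preimage_affine.
  by congr ((_^-1)%:E * _)%E; rewrite -normrN; congr (`|_|); ring.
by apply: contra_neq det0 => h; rewrite -[RHS]oppr0 -h; ring.
Qed.

End area_transport.

(** * Circular segments *)

Section circle.
Context {R : realType}.
Implicit Types x y : R.

Definition csqrt y : R := Num.sqrt (1 - y ^+ 2).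
(** For 0 <= x <= 1, the part of the unit disc beyond a line at distance x from the center;
    [asin (csqrt x)] is its half-angle acos x. *)
Definition segment_area x : R := asin (csqrt x) - x * csqrt x.

Lemma continuous_csqrt : continuous csqrt.
Proof.
move=> y; apply: (@continuous_comp _ _ _ (fun y => 1 - y ^+ 2) Num.sqrt).
  by apply: cvgB; [exact: cvg_cst|exact: exprn_continuous].
exact: sqrt_continuous.
Qed.

Lemma csqrt_ge0 x : 0 <= csqrt x. Proof. exact: sqrtr_ge0. Qed.

Lemma csqrt_sqr x : -1 <= x <= 1 -> csqrt x ^+ 2 = 1 - x ^+ 2.
Proof. by move=> xx; rewrite sqr_sqrtr//; nra. Qed.

Lemma csqrt_gt0 x : -1 < x < 1 -> 0 < csqrt x.
Proof. by move=> xx; rewrite sqrtr_gt0; nra. Qed.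

Lemma csqrt_le1 x : csqrt x <= 1.
Proof.
rewrite -[leRHS]sqrtr1; apply: ler_wsqrtr; nra.
Qed.

Lemma csqrt_lt1 x : 0 < x -> csqrt x < 1.
Proof.
move=> x0; rewrite -[ltRHS]sqrtr1; rewrite ltr_sqrt//; nra.
Qed.

Lemma csqrtK x : 0 <= x <= 1 -> csqrt (csqrt x) = x.
Proof.
move=> xx; rewrite {1}/csqrt csqrt_sqr; last lra.
by rewrite opprB addrC subrK sqrtr_sqr ger0_norm//; lra.
Qed.

Lemma csqrtN x : csqrt (- x) = csqrt x.
Proof. by rewrite /csqrt sqrrN. Qed.

Lemma is_derive_csqrt x : -1 < x < 1 ->
  is_derive x 1 csqrt (- x / csqrt x).
Proof.
move=> xx.
have h : 0 < 1 - x ^+ 2 by nra.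
have d1 : is_derive x 1 (fun y : R => 1 - y ^+ 2) (- (2 * x)).
  by apply: is_derive_eq; rewrite /= ?scaler1 ?add0r; ring.
have := @is_derive1_comp _ Num.sqrt (fun y : R => 1 - y ^+ 2) _ _ _ (is_derive1_sqrt h) d1.
rewrite -/(csqrt x); have s0 := csqrt_gt0 xx.
move=> d; have -> : - x / csqrt x = (2 * csqrt x)^-1 * - (2 * x) by field; lra.
exact: d.
Qed.

Lemma asin_ge0 x : 0 <= x <= 1 -> 0 <= asin x.
Proof.
move=> xx; rewrite leNgt; apply/negP => a0.
have x11 : -1 <= x <= 1 by lra.
have : 0 < sin (- asin x).
  by apply: sin_gt0_pi; have := asin_geNpi2 x11; have := @pi_gt0 R; lra.
by rewrite sinN asinK ?in_itv//=; lra.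
Qed.

Lemma asinN x : -1 <= x <= 1 -> asin (- x) = - asin x.
Proof.
move=> xx; rewrite -[RHS]sinK.
  by rewrite sinN asinK.
rewrite in_itv /=; have := asin_geNpi2 xx; have := asin_lepi2 xx; lra.
Qed.

Definition semidisc_prim x y := (y * csqrt y + asin y) / 2 - x * y.

Lemma is_derive_semidisc_prim x y : -1 < y < 1 -> is_derive y 1 (semidisc_prim x)
    (csqrt y - x).
Proof.
move=> yy; have d1 := is_derive_csqrt yy; have d2 := is_derive1_asin yy.
have -> : semidisc_prim x = (fun y => (2^-1) *: (y * csqrt y + asin y) - x *: y).
  by apply/funext => z; rewrite /semidisc_prim [_ / 2]mulrC.
apply: is_derive_eq; rewrite -/(csqrt y) /=.
have s0 := csqrt_gt0 yy.
have : csqrt y ^+ 2 = 1 - y ^+ 2 by apply: csqrt_sqr; lra.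
rewrite /GRing.scale /=.
move: (csqrt y) s0 => s s0 s2.
have -> : y * (- y / s) + s * 1 + s^-1 = (- y ^+ 2 + s ^+ 2 + 1) / s by field; lra.
rewrite (_ : - y ^+ 2 + s ^+ 2 + 1 = s * s * 2); last by rewrite -expr2 s2; ring.
field; lra.
Qed.

Lemma continuous_semidisc_prim x y : -1 < y < 1 -> {for y, continuous (semidisc_prim x)}.
Proof.
move=> yy; apply: differentiable_continuous; apply/derivable1_diffP.
by have := is_derive_semidisc_prim x yy => d; apply: ex_derive.
Qed.

(** The integrand is supported between the heights [- csqrt x] and [csqrt x]. Positivity of x keeps
    them inside ]-1, 1[, where the primitive is differentiable. *)
Lemma integral_csqrtB x : 0 < x <= 1 ->
  (\int[mu]_y (Num.max 0 (csqrt y - x))%:E)%E = (segment_area x)%:E.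
Proof.
move=> xx; pose w := csqrt x.
have w0 : 0 <= w := csqrt_ge0 x.
have w1 : w < 1 by apply: csqrt_lt1; lra.
have w2 : w ^+ 2 = 1 - x ^+ 2 by apply: csqrt_sqr; lra.
have out y : (y \in `[-w, w]) = false -> csqrt y <= x.
  rewrite in_itv /= => yw; rewrite -[leRHS](@csqrtK x); last lra.
  apply: ler_wsqrtr; rewrite -/w; nra.
have inn y : y \in `[-w, w] -> x <= csqrt y.
  rewrite in_itv /= => yw; rewrite -[leLHS](@csqrtK x); last lra.
  apply: ler_wsqrtr; rewrite -/w; nra.
(* For x = 1 the interval of integration shrinks to a point, where the fundamental theorem does not
   apply. *)
have [x1|x1] := eqVneq x 1.
  rewrite x1 /segment_area; have -> : csqrt 1 = 0 by rewrite /csqrt expr1n subrr sqrtr0.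
  rewrite (_ : asin 0 = 0); last first.
    by rewrite -[in LHS](@sin0 R) sinK// in_itv/=; have := @pi_gt0 R; lra.
  rewrite mulr0 subrr; apply: integral0_eq => y _.
  by rewrite max_l// subr_le0 csqrt_le1.
have w00 : 0 < w by apply: csqrt_gt0; lra.
transitivity (\int[mu]_(y in `[(- w)%R, w%R]) (csqrt y - x)%:E)%E.
  rewrite [RHS]integral_mkcond; apply: eq_integral => y _; rewrite patchE.
  rewrite mem_setE; case: ifPn => yw; first by rewrite max_r// subr_ge0; apply: inn.
  by rewrite max_l// subr_le0; apply: out; apply/negbTE.
rewrite (@continuous_FTC2 _ _ (semidisc_prim x)).
- rewrite -EFinB; congr EFin; rewrite /semidisc_prim csqrtN asinN; last lra.
  rewrite /segment_area -/w (_ : csqrt w = x); last by apply: csqrtK; lra.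
  by field.
- lra.
- apply: continuous_subspaceT => y; apply: cvgB; last exact: cvg_cst.
  exact: continuous_csqrt.
- split.
  + move=> y; rewrite in_itv /= => yw;
      have [] // : is_derive y 1 (semidisc_prim x) (csqrt y - x).
    by apply: is_derive_semidisc_prim; lra.
  + by apply: cvg_at_right_filter; apply: continuous_semidisc_prim; lra.
  + by apply: cvg_at_left_filter; apply: continuous_semidisc_prim; lra.
- move=> y; rewrite in_itv /= => yw; rewrite derive1E.
  by have [] // : is_derive y 1 (semidisc_prim x) (csqrt y - x)
    by apply: is_derive_semidisc_prim; lra.
Qed.

(** Moving the line outwards removes area at the rate of the chord length, 2 sqrt (1 - x^2). *)
Lemma is_derive_segment_area x : 0 < x < 1 -> is_derive x 1 segment_area (- 2 * csqrt x).
Proof.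
move=> xx; have x11 : -1 < x < 1 by lra.
have s0 := csqrt_gt0 x11; have s1 : csqrt x < 1 by apply: csqrt_lt1; lra.
have d1 := is_derive_csqrt x11.
have s11 : -1 < csqrt x < 1 by lra.
have d2 := is_derive1_comp (is_derive1_asin s11) d1.
have s2 : csqrt x ^+ 2 = 1 - x ^+ 2 by apply: csqrt_sqr; lra.
have d3 : is_derive x 1 (fun x => (asin \o csqrt) x - x * csqrt x) (- 2 * csqrt x).
  apply: is_derive_eq.
  rewrite -/(csqrt (csqrt x)) csqrtK; last lra.
  rewrite /GRing.scale /=; move: (csqrt x) s0 s2 => s s0 s2.
  rewrite mulr1.
  have -> : x^-1 * (- x / s) - (x * (- x / s) + s) = (- 1 + x ^+ 2 - s ^+ 2) / s.
    by field; lra.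
  have -> : -1 + x ^+ 2 - s ^+ 2 = - 2 * s ^+ 2 by rewrite s2; ring.
  by field; lra.
exact: d3.
Qed.

Definition halfwidth : R := 1 / Num.sqrt 5.

Lemma halfwidth_gt0 : 0 < halfwidth.
Proof. by rewrite divr_gt0// sqrtr_gt0. Qed.

Lemma halfwidth_sqr : halfwidth ^+ 2 = 1 / 5.
Proof. by rewrite expr_div_n sqr_sqrtr ?expr1n. Qed.

Lemma halfwidth_bounds : 2 / 5 < halfwidth < 1 / 2.
Proof. have := halfwidth_gt0; have := halfwidth_sqr => h h0; nra. Qed.

Lemma csqrt_halfwidth : csqrt halfwidth = 2 * halfwidth.
Proof.
rewrite /csqrt halfwidth_sqr -[RHS]ger0_norm -?sqrtr_sqr.
  by rewrite exprMn halfwidth_sqr; congr Num.sqrt; lra.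
by have := halfwidth_gt0; lra.
Qed.

Lemma csqrt_2halfwidth : csqrt (2 * halfwidth) = halfwidth.
Proof. by rewrite -csqrt_halfwidth csqrtK//; have := halfwidth_bounds; lra. Qed.

Definition band_area a := segment_area a - segment_area (2 * a).

(** With h = 1 / sqrt 5, the point (h, 2 h) lies on the unit circle, so the algebraic terms of the
    two segments cancel. What remains is a difference of two angles, with sine 3/5 and cosine
    4/5. *)
Lemma band_area_halfwidth : band_area halfwidth = atan (3 / 4).
Proof.
have hb := halfwidth_bounds.
rewrite /band_area /segment_area csqrt_2halfwidth csqrt_halfwidth.
set b := (X in X - _ - (_ - _)); set c := asin halfwidth.
have -> : b - halfwidth * (2 * halfwidth) - (c - 2 * halfwidth * halfwidth) = b - c by ring.
have b0 : 0 <= b by apply: asin_ge0; lra.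
have c0 : 0 <= c by apply: asin_ge0; lra.
have b1 : b < pi / 2 by apply: asin_ltpi2; lra.
have c1 : c < pi / 2 by apply: asin_ltpi2; lra.
rewrite -[LHS]tanK; last by rewrite in_itv /=; lra.
congr atan; rewrite /tan sinB cosB /b /c !cos_asin; try lra.
rewrite !asinK ?in_itv/=; try lra.
rewrite -!/(csqrt _) csqrt_halfwidth csqrt_2halfwidth.
have -> : 2 * halfwidth * (2 * halfwidth) - halfwidth * halfwidth = 3 / 5.
  by have := halfwidth_sqr; lra.
have -> : halfwidth * (2 * halfwidth) + 2 * halfwidth * halfwidth = 4 / 5.
  by have := halfwidth_sqr; lra.
by field.
Qed.

Lemma continuous_segment_area x : 0 < x <= 1 -> {for x, continuous segment_area}.
Proof.
move=> xx; apply: cvgB; last by apply: cvgM => //; exact: continuous_csqrt.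
apply: (@continuous_comp _ _ _ csqrt asin); first exact: continuous_csqrt.
apply: continuous_asin; have := csqrt_ge0 x; have := @csqrt_lt1 x; lra.
Qed.

Lemma is_derive_band_area x : 0 < x < 1 / 2 ->
  is_derive x 1 band_area (4 * csqrt (2 * x) - 2 * csqrt x).
Proof.
move=> xx.
have d1 : is_derive x 1 segment_area (- 2 * csqrt x) by apply: is_derive_segment_area; lra.
have d2 : is_derive (2 * x) 1 segment_area (- 2 * csqrt (2 * x))
    by apply: is_derive_segment_area; lra.
have d3 : is_derive x 1 (fun x : R => 2 * x) 2.
  by apply: is_derive_eq; rewrite /GRing.scale /=; ring.
have d4 := is_derive1_comp d2 d3.
have d5 : is_derive x 1 (fun x => segment_area x - (segment_area \o (fun x : R => 2 * x)) x)
    (4 * csqrt (2 * x) - 2 * csqrt x).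
  by apply: is_derive_eq; ring.
exact: d5.
Qed.

(** The derivative has the sign of 4 (1 - 4 x^2) - (1 - x^2) = 3 - 15 x^2: the band grows up to
    [halfwidth] and shrinks afterwards. *)
Lemma band_area_lt a : 0 < a <= 1 / 2 -> a != halfwidth -> band_area a < atan (3 / 4).
Proof.
move=> a0 ane; rewrite -band_area_halfwidth; have hb := halfwidth_bounds.
have cont x y : 0 < x -> y <= 1 / 2 -> {within `[x, y], continuous band_area}.
  move=> x0 y0; apply: continuous_in_subspaceT => z; rewrite mem_setE in_itv /= => zz.
  apply: cvgB; first by apply: continuous_segment_area; lra.
  apply: (@continuous_comp _ _ _ (fun x : R => 2 * x) segment_area).
    by apply: cvgM => //; exact: cvg_cst.
  by apply: continuous_segment_area; lra.
have [ah|ah] : a < halfwidth \/ halfwidth < a by move/lt_total : ane => /orP[];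
    [left|right].
- have [| |c] := @MVT R band_area (fun x => 4 * csqrt (2 * x) - 2 * csqrt x) _ _ ah.
  + by move=> x; rewrite in_itv /= => xx; apply: is_derive_band_area; lra.
  + by apply: cont; lra.
  rewrite in_itv /= => cc e.
  suff : 0 < 4 * csqrt (2 * c) - 2 * csqrt c by nra.
  have := @csqrt_sqr (2 * c); have := @csqrt_sqr c.
  have := csqrt_ge0 (2 * c); have := csqrt_ge0 c.
  have := halfwidth_sqr => hs.
  have c2 : c ^+ 2 < 1 / 5 by nra.
  move=> h1 h2 h3 h4; have := h3 ltac:(lra); have := h4 ltac:(lra); nra.
- have [| |c] := @MVT R band_area (fun x => 4 * csqrt (2 * x) - 2 * csqrt x) _ _ ah.
  + by move=> x; rewrite in_itv /= => xx; apply: is_derive_band_area; lra.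
  + by apply: cont; lra.
  rewrite in_itv /= => cc e.
  suff : 0 < 2 * csqrt c - 4 * csqrt (2 * c) by nra.
  have := @csqrt_sqr (2 * c); have := @csqrt_sqr c.
  have := csqrt_ge0 (2 * c); have := csqrt_ge0 c.
  have := halfwidth_sqr => hs.
  have c2 : 1 / 5 < c ^+ 2 by nra.
  move=> h1 h2 h3 h4; have := h3 ltac:(lra); have := h4 ltac:(lra); nra.
Qed.

(** The angle t has sine 3/5, and sin t <= t. This makes the area bound 1 of the case a <= 1/4
    strict. *)
Lemma atan34_gt : 1 / 2 < atan (3 / 4 : R).
Proof.
set t := atan _.
have t0 : 0 < t by rewrite -(@atan0 R) -ltr_tan ?atanK ?in_itv /= ?atan_gtNpi2
    ?atan_ltpi2//; lra.
have st : sin t = 3 / 5.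
  have c0 : cos t = 4 / 5.
    rewrite /t cos_atan (_ : 1 + _ = (5 / 4) ^+ 2); last by field.
    by rewrite sqrtr_sqr ger0_norm; [field|lra].
  have := atanK (3 / 4 : R); rewrite -/t /tan c0; lra.
have [|c _] := @MVT R sin cos _ _ t0.
  by apply: continuous_subspaceT; exact: continuous_sin.
by rewrite sin0 st !subr0; have := cos_le1 c; nra.
Qed.

End circle.

(** * Horizontal slices of a normalized body *)

Section slices.
Context {R : realType}.
Implicit Types (K S : set (R * R)) (A B : set R).

Definition cvx K := forall (p q : R * R) (t : R), K p -> K q -> 0 <= t <= 1 ->
  K ((1 - t) * p.1 + t * q.1, (1 - t) * p.2 + t * q.2).

Lemma mu_le_itv A (u v : R) : measurable A -> A `<=` `[u, v] -> u <= v ->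
  (mu A <= (v - u)%:E)%E.
Proof.
move=> mA sA uv; apply: (@le_trans _ _ (mu (`[u, v] : set R))).
  by apply: le_measure; rewrite ?inE.
rewrite lebesgue_measure_itv /= lte_fin.
by case: ltP => // vu; rewrite lee_fin; lra.
Qed.

Lemma mu_le_width A (d : R) : measurable A -> 0 <= d ->
  (forall x y, A x -> A y -> x - y <= d) -> (mu A <= d%:E)%E.
Proof.
move=> mA d0 Ad; have [->|/set0P[x Ax]] := eqVneq A set0; first by rewrite measure0.
have hs : has_sup A by split; [exists x|exists (x + d) => y Ay; have := Ad y x Ay Ax; lra].
have hi : has_inf A by split; [exists x|exists (x - d) => y Ay; have := Ad x y Ax Ay; lra].
have sU := ub_le_sup hs.2; have iL := ge_inf hi.2.
apply: (@le_trans _ _ (sup A - inf A)%:E).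
  apply: mu_le_itv => // [y Ay|].
    by rewrite /= in_itv /= iL ?sU.
  by apply: (@le_trans _ _ x); [exact: iL|exact: sU].
rewrite lee_fin lerBlDr; apply: ge_sup; first by exists x.
move=> y Ay; rewrite addrC -lerBlDr; apply: lb_le_inf; first by exists x.
by move=> z Az; have := Ad y z Ay Az; lra.
Qed.

(** One-dimensional Brunn-Minkowski: the sum set lies in an interval of length 4 a. Explicitly, A
    lies between its bounds and B between [- 2 * a - inf A] and [2 * a - sup A]; the two lengths add
    up to 4 a. *)
Lemma mu_pair_le A B (a : R) : measurable A -> measurable B -> A !=set0 -> B !=set0 ->
  (forall x y, A x -> B y -> `|x + y| <= 2 * a) -> (mu A + mu B <= (4 * a)%:E)%E.
Proof.
move=> mA mB [x Ax] [y By] AB.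
have AB' z w : A z -> B w -> - (2 * a) <= z + w <= 2 * a.
  by move=> Az Bw; rewrite -ler_norml; apply: AB.
have hs : has_sup A by split; [exists x|exists (2 * a - y) => z Az;
    have := AB' z y Az By; lra].
have hi : has_inf A by split; [exists x|exists (- 2 * a - y) => z Az;
    have := AB' z y Az By; lra].
have sU := ub_le_sup hs.2; have iL := ge_inf hi.2.
have xs : x <= sup A by exact: sU.
have xi : inf A <= x by exact: iL.
have Bs w : B w -> w <= 2 * a - sup A.
  move=> Bw; rewrite lerBrDr addrC -lerBrDr; apply: ge_sup; first by exists x.
  by move=> z Az; have := AB' z w Az Bw; lra.
have Bi w : B w -> - 2 * a - inf A <= w.
  move=> Bw; rewrite lerBlDr addrC -lerBlDr; apply: lb_le_inf; first by exists x.
  by move=> z Az; have := AB' z w Az Bw; lra.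
have muA : (mu A <= (sup A - inf A)%:E)%E.
  apply: mu_le_itv => //; last lra.
  by move=> z Az; rewrite /= in_itv /=; apply/andP; split; [exact: iL|exact: sU].
have muB : (mu B <= (2 * a - sup A - (- 2 * a - inf A))%:E)%E.
  apply: mu_le_itv => //; last by have := Bs _ By; have := Bi _ By; lra.
  by move=> z Bz; rewrite /= in_itv /= Bs ?Bi.
apply: (le_trans (leeD muA muB)); rewrite -EFinD lee_fin; lra.
Qed.

Lemma continuous_pair (T : topologicalType) (f g : T -> R) :
  continuous f -> continuous g -> continuous (fun x => (f x, g x)).
Proof. by move=> cf cg x; exact: (cvg_pair (cf x) (cg x)). Qed.

Lemma closed_ysection S y : closed S -> closed (ysection S y).
Proof.
move=> cS.
have -> : ysection S y = (fun x => (x, y)) @^-1` S by apply/seteqP; split => x;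
    rewrite /ysection /= inE.
apply: preimage_closed => // x _.
by apply: continuous_pair => z; [exact: cvg_id|exact: cvg_cst].
Qed.

(* [-a, a] x {0} is the dividing chord, and both parts have diameter at most 1. *)
Record normalized K (a : R) : Prop := Normalized {
  nclosed : closed K;
  ncvx : cvx K;
  na : 0 <= a <= 1 / 2;
  nwidth : forall x y z, K (x, z) -> K (y, z) -> x - y <= 1;
  nlens : forall x y, K (x, y) -> (`|x| + a) ^+ 2 + y ^+ 2 <= 1;
  nchord : forall x, K (x, 0) -> `|x| <= a }.

(** For x >= 0, the length at height y of the part of the unit disc to the right of abscissa x. *)
Definition segment_width (x y : R) := Num.max 0 (csqrt y - x).

(** * Upper bound for the area in normal position *)

Section bound.
Variables (K : set (R * R)) (a : R).
Hypothesis nK : normalized K a.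
Let m y := mu (ysection K y).

Let mK : measurable K. Proof. by apply: closed_measurable2; case: nK. Qed.
Let mS y : measurable (ysection K y). Proof. exact: measurable_ysection. Qed.

Lemma normalized_le_csqrt x y : K (x, y) -> `|x| <= csqrt y - a.
Proof.
case: nK => cK vK a0 w l c Kxy; have := l _ _ Kxy => h.
rewrite lerBrDr -[leLHS]ger0_norm; last by have := normr_ge0 x; lra.
by rewrite -sqrtr_sqr; apply: ler_wsqrtr; lra.
Qed.

Lemma slice_le y : (m y <= (2 * segment_width a y)%:E)%E.
Proof.
apply: mu_le_width; [exact: mS|by rewrite mulr_ge0// le_max lexx|].
move=> x x'; rewrite /ysection /= !inE => /normalized_le_csqrt h1 /normalized_le_csqrt h2.
have : csqrt y - a <= segment_width a y by rewrite le_max lexx orbT.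
by move: h1 h2; rewrite !ler_norml; lra.
Qed.

Lemma slice_le1 y : (m y <= 1%:E)%E.
Proof.
apply: mu_le_width => [||x x']; [exact: mS|exact: ler01|rewrite /ysection /= !inE].
exact: (nwidth nK).
Qed.

Lemma slice0 y : ysection K y = set0 -> m y = 0.
Proof. by rewrite /m => ->; rewrite measure0. Qed.

Lemma slice_pair y : (m y + m (- y) <= (Num.max (4 * a) 1)%:E)%E.
Proof.
have [e|/set0P Ay] := eqVneq (ysection K y) set0.
  (* With one slice empty there are no midpoints to use; the other slice alone has width at most
     1. *)
  by rewrite slice0// add0e (le_trans (slice_le1 _))// lee_fin le_max lexx orbT.
have [e|/set0P By] := eqVneq (ysection K (- y)) set0.
  by rewrite (@slice0 (- y))// adde0 (le_trans (slice_le1 _))// lee_fin le_max lexx orbT.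
apply: (@le_trans _ _ (4 * a)%:E); last by rewrite lee_fin le_max lexx.
apply: (mu_pair_le (mS y) (mS (- y)) Ay By) => x x'; rewrite /ysection /= !inE => Kx Kx'.
case: nK => _ vK _ _ _ c.
have := vK _ _ (1 / 2) Kx Kx'; rewrite /= => h.
have /c : K ((x + x') / 2, 0).
  have -> : ((x + x') / 2, 0) =
      ((1 - 1 / 2) * x + 1 / 2 * x', (1 - 1 / 2) * y + 1 / 2 * - y).
    by congr pair; lra.
  by apply: h; lra.
by rewrite normrM [`|2^-1|]ger0_norm//; lra.
Qed.

(* Adding the mirror image of K pairs the slices at heights y and -y. *)
Lemma mu2_double : (mu2 K + mu2 K = \int[mu]_y (m y + m (- y)%R))%E.
Proof.
pose K' := affine 1 0 0 0 (-1) 0 @^-1` K.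
have mK' : measurable K' by exact: measurable_preimage_affine.
have -> : (mu2 K + mu2 K = mu2 K + mu2 K')%E.
  have d0 : 1 * -1 - 0 * 0 != 0 :> R by rewrite mul0r subr0 mul1r oppr_eq0 oner_eq0.
  congr (_ + _)%E; rewrite (mu2_affine _ _ d0)//.
  by rewrite mul0r subr0 mul1r normrN1 invr1 mul1e.
rewrite !mu2E2// -ge0_integralD//;
    [|exact: measurable_fun_ysection|exact: measurable_fun_ysection].
apply: eq_integral => y _; congr (_ + mu _)%E.
apply/seteqP; split => x; rewrite /ysection /= !inE /K' /affine /=;
by rewrite !(mul1r, mul0r, addr0, add0r) mulN1r.
Qed.

Let mm : measurable_fun setT (fun y => m y + m (- y)%R)%E.
Proof.
apply: emeasurable_funD; first exact: measurable_fun_ysection.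
by apply: (measurableT_comp (measurable_fun_ysection (@lebesgue_measure R) mK)).
Qed.

Lemma segment_width_ge0 x y : 0 <= segment_width x y. Proof. by rewrite le_max lexx. Qed.

Lemma measurable_segment_width x : measurable_fun setT (fun y => (segment_width x y)%:E).
Proof.
apply/measurable_EFinP; apply: measurable_maxr => //.
apply: measurable_funB => //.
exact: continuous_measurable_fun continuous_csqrt.
Qed.

Lemma measurable_segment_widthM c x :
  measurable_fun setT (fun y => (c * segment_width x y)%:E).
Proof.
apply/measurable_EFinP; apply: measurable_funM => //.
by have /measurable_EFinP := measurable_segment_width x.
Qed.

Lemma integral_segment_width (c x : R) : 0 <= c -> 0 < x <= 1 ->
  (\int[mu]_y (c * segment_width x y)%:E)%E = (c * segment_area x)%:E.
Proof.
move=> c0 xx; under eq_integral do rewrite EFinM.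
rewrite ge0_integralZl//; last first.
- by move=> y _; rewrite lee_fin segment_width_ge0.
- exact: measurable_segment_width.
by rewrite integral_csqrtB// EFinM.
Qed.

(* min(a, s - a)^+ = (s - a)^+ - (s - 2a)^+, with both sides moved so that no
   subtraction of extended reals occurs. *)
Lemma slice_pair_segment_width y : 1 / 4 <= a ->
  (m y + m (- y)%R + (4 * segment_width (2 * a) y)%:E <= (4 * segment_width a y)%:E)%E.
Proof.
move=> a4; have h1 := slice_le y; have := slice_le (- y).
rewrite (_ : segment_width a (- y) = segment_width a y) => [h2|];
    last by rewrite /segment_width csqrtN.
have := slice_pair y; rewrite max_l; last lra.
case: nK => _ _ a0 _ _ _.
have [le2|gt2] := leP (csqrt y) (2 * a).
  move=> _; have -> : segment_width (2 * a) y = 0 by rewrite /segment_width max_l//; lra.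
  rewrite mulr0 adde0; apply: (le_trans (leeD h1 h2)).
  by rewrite -EFinD lee_fin; lra.
have -> : segment_width (2 * a) y = csqrt y - 2 * a by rewrite /segment_width max_r//; lra.
have -> : segment_width a y = csqrt y - a by rewrite /segment_width max_r//; lra.
move=> h; apply: (le_trans (leeD2r _ h)); rewrite -EFinD lee_fin; lra.
Qed.

(** For a <= 1/4 paired slices have total width at most 1, and slices beyond height 1 are empty, so
    twice the area is at most the length of [-1, 1]. *)
Lemma mu2_small : a <= 1 / 4 -> (mu2 K <= 1%:E)%E.
Proof.
move=> a4; suff : (mu2 K + mu2 K <= 2%:E)%E.
  case: (mu2 K) => [r||]; rewrite ?leNye//; first by rewrite -EFinD !lee_fin; lra.
rewrite mu2_double.
apply: (@le_trans _ _ (\int[mu]_(y in `[(-1)%R, 1%R]) (cst 1%:E y))%E); last first.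
  rewrite integral_cst; [|exact: measurable_itv].
  rewrite /= lebesgue_measure_itv /= lte_fin ifT; last lra.
  by rewrite -EFinB -EFinM lee_fin; lra.
rewrite [leRHS]integral_mkcond; apply: ge0_le_integral => //.
- by move=> y _; rewrite adde_ge0// measure_ge0.
- by apply/(measurable_restrictT _ (measurable_itv _)); exact: measurable_cst.
move=> y _; rewrite patchE mem_setE in_itv /=; case: ifPn => y1.
  by apply: (le_trans (slice_pair y)); rewrite lee_fin ge_max lexx andbT; lra.
have e z : z = y \/ z = - y -> ysection K z = set0.
  move=> zy; apply/seteqP; split => // x; rewrite /ysection /= inE.
  case: nK => _ _ a0 _ l _ /l; move/negP: y1 => y1 h; apply: y1.
  have y2 : y ^+ 2 <= 1.
    by case: zy h => ->; rewrite ?sqrrN; have := sqr_ge0 (`|x| + a); lra.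
  by apply/andP; split; nra.
by rewrite !slice0 ?adde0//; apply: e; [right|left].
Qed.

Lemma mu2_big : 1 / 4 <= a -> (mu2 K <= (2 * band_area a)%:E)%E.
Proof.
move=> a4; have a0 := na nK.
suff : (mu2 K + mu2 K + (4 * segment_area (2 * a))%:E <= (4 * segment_area a)%:E)%E.
  rewrite /band_area; case: (mu2 K) => [r||]; rewrite ?leNye//;
      first by rewrite -!EFinD !lee_fin; lra.

rewrite mu2_double -!integral_segment_width//; [|lra|lra].
rewrite -ge0_integralD//; [|by move=> y _; rewrite adde_ge0// measure_ge0|
  by move=> y _; rewrite lee_fin mulr_ge0// segment_width_ge0|exact:
      measurable_segment_widthM].
apply: ge0_le_integral => //; [|by apply: emeasurable_funD => //;
    exact: measurable_segment_widthM|
  exact: measurable_segment_widthM|by move=> y _; exact: slice_pair_segment_width].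
move=> y _; rewrite !adde_ge0 ?measure_ge0//.
by rewrite lee_fin mulr_ge0// segment_width_ge0.
Qed.

End bound.
End slices.

(** * The equality case *)

Section equality.
Context {R : realType}.
Implicit Types (K S : set (R * R)) (A B : set R).

(** The difference g - f is nonnegative, and its integral vanishes because the common finite
    integral can be cancelled. *)
Lemma ae_eq_of_integral_eq (f g : R -> \bar R) :
  measurable_fun setT f -> measurable_fun setT g ->
  (forall y, 0 <= f y)%E -> (forall y, f y <= g y)%E -> (forall y, g y \is a fin_num) ->
  (\int[mu]_y f y = \int[mu]_y g y)%E -> (\int[mu]_y g y)%E \is a fin_num ->
  {ae mu, forall y, f y = g y}.
Proof.
move=> mf mg f0 fg gfin eqI Ifin.
have ffin y : f y \is a fin_num.
  rewrite ge0_fin_numE//; apply: (le_lt_trans (fg y)).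
  by rewrite -ge0_fin_numE// (le_trans (f0 y)).
have mh : measurable_fun setT (fun y => g y - f y)%E by exact: emeasurable_funB.
have h0 y : (0 <= g y - f y)%E by rewrite sube_ge0// ?ffin ?fg// orbT.
have Ih : (\int[mu]_y `|g y - f y| = 0)%E.
  have : (\int[mu]_y g y = \int[mu]_y f y + \int[mu]_y (g y - f y))%E.
    rewrite -ge0_integralD//; apply: eq_integral => y _.
    by rewrite addeC subeK.
  rewrite eqI => e.
  under eq_integral do rewrite gee0_abs//.
  set I := (\int[mu]_y g y)%E in Ifin e *; set X := (\int[mu]_y _)%E in e *.
  have : (I - I = I + X - I)%E by rewrite -e.
  by rewrite subee// [(I + X)%E]addeC addeK.
have /ae_eq_integral_abs := Ih.
move=> /(_ measurableT mh) [N [mN N0 sN]].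
exists N; split => // y /= ne; apply: sN => /= e; apply: ne.
by rewrite -[RHS](subeK _ (ffin y)) e// add0e.
Qed.

(** A closed set contains its supremum, and A fits between - d and [sup A]; full measure forces
    [sup A] to be d. *)
Lemma full_measure_right_end A (d : R) : closed A -> A `<=` `[- d, d] -> 0 < d ->
  mu A = (2 * d)%:E -> A d.
Proof.
move=> cA sA d0 mA.
have msA : measurable A by exact: closed_measurable.
have /set0P[x Ax] : A != set0.
  by apply/eqP => A0; move: mA; rewrite A0 measure0 => -[]; lra.
have bA z : A z -> - d <= z <= d by move/sA; rewrite /= in_itv.
have hs : has_sup A by split; [exists x|exists d => z /bA; lra].
have sU := ub_le_sup hs.2.
have As : A (sup A) by apply: cA; exact: closure_sup hs.1 hs.2.
have : ((2 * d)%:E <= (sup A - - d)%:E)%E.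
  rewrite -mA; apply: mu_le_itv => //; last by have := bA _ As; lra.
  by move=> z Az; rewrite /= in_itv /= sU// andbT; have := bA _ Az; lra.
rewrite lee_fin => h; have := bA _ As => h'.
by rewrite (_ : d = sup A)//; lra.
Qed.

Lemma full_measure_ends A (d : R) : closed A -> A `<=` `[- d, d] -> 0 < d ->
  mu A = (2 * d)%:E -> A d /\ A (- d).
Proof.
move=> cA sA d0 mA; split; first exact: full_measure_right_end.
apply: (@full_measure_right_end (-%R @^-1` A)) => //.
- by apply: preimage_closed => // z _; exact: opp_continuous.
- by move=> z /sA; rewrite /= !in_itv /=; lra.
- by rewrite -mA -(@lebesgue_measureN R A)//; exact: closed_measurable.
Qed.

(** A missing point, even u or v, would have a neighborhood outside A, which meets ]u, v[ in an
    interval of positive length. *)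
Lemma closed_ae_dense A (u v : R) : closed A -> u < v ->
  {ae mu, forall y, u < y < v -> A y} -> forall y, u <= y <= v -> A y.
Proof.
move=> cA uv [N [mN N0 sN]] y yuv; apply: contrapT => nAy.
have : nbhs y (~` A) by apply: open_nbhs_nbhs; split => //; exact: closed_openC.
move=> /nbhs_ballP[e /= e0 be].
pose l := Num.max u (y - e); pose r := Num.min v (y + e).
have lr : l < r by rewrite gt_max !lt_min; apply/andP; split; apply/andP; split; lra.
have : (mu `]l, r[ <= mu N)%E.
  apply: le_measure; rewrite ?inE// => z /=; rewrite in_itv /= => /andP[].
  rewrite gt_max lt_min => /andP[h1 h2] /andP[h3 h4]; apply: sN => /= h.
  by apply: (be z); [rewrite -ball_normE /= ltr_norml; lra|apply: h; lra].
rewrite N0 lebesgue_measure_itv /= lte_fin lr -EFinB lee_fin; lra.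
Qed.

(** For |y| < a equality fixes only the sum of the widths at y and -y, so slices are read off for a
    < |y| < 2 a alone. Closedness adds the corners of the square [-a, a] x [-a, a], and convexity
    does the rest. *)
Lemma normalized_extremal K : normalized K halfwidth ->
  mu2 K = (2 * atan (3 / 4))%:E -> K = Qset R.
Proof.
set a := halfwidth => nK areaK.
have ha := @halfwidth_bounds R; have ha2 := @halfwidth_sqr R; rewrite -/a in ha ha2.
have mK : measurable K by apply: closed_measurable2; case: nK.
pose f y := (mu (ysection K y) + mu (ysection K (- y)%R) + (4 * segment_width (2 * a)
    y)%:E)%E.
pose g y := (4 * segment_width a y)%:E.
have mm : measurable_fun setT (fun y => mu (ysection K y) + mu (ysection K (- y)%R))%E.
  apply: emeasurable_funD; first exact: measurable_fun_ysection.
  by apply: (measurableT_comp (measurable_fun_ysection (@lebesgue_measure R) mK)).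
have Ig : (\int[mu]_y g y = (4 * segment_area a)%:E)%E
    by apply: integral_segment_width; lra.
have ae_fg : {ae mu, forall y, f y = g y}.
  apply: ae_eq_of_integral_eq.
  - by apply: emeasurable_funD => //; exact: measurable_segment_widthM.
  - exact: measurable_segment_widthM.
  - by move=> y; rewrite !adde_ge0 ?measure_ge0// lee_fin mulr_ge0// segment_width_ge0.
  - by move=> y; apply: slice_pair_segment_width => //; lra.
  - by [].
  - rewrite Ig ge0_integralD//; last first.
    + exact: measurable_segment_widthM.
    + by move=> y _; rewrite lee_fin mulr_ge0// segment_width_ge0.
    + by move=> y _; rewrite adde_ge0 ?measure_ge0.
    rewrite -(mu2_double nK) integral_segment_width; [|lra|lra].
    by rewrite areaK -!EFinD -band_area_halfwidth /band_area -/a; congr EFin; ring.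
  - by rewrite Ig.
have cs1 : csqrt a = 2 * a by exact: csqrt_halfwidth.
have cs2 : csqrt (2 * a) = a by exact: csqrt_2halfwidth.
have csI y : a <= y <= 2 * a -> a <= csqrt y <= 2 * a.
  move=> yy; rewrite -{1}cs2 -cs1; apply/andP; split; apply: ler_wsqrtr; nra.
have csI' y : a < y < 2 * a -> a < csqrt y <= 2 * a.
  move=> yy; have := @csI y ltac:(lra) => /andP[h ->]; rewrite andbT.
  rewrite -{1}cs2 ltr_sqrt; nra.
have ends y : f y = g y -> a < csqrt y <= 2 * a ->
    K (csqrt y - a, y) /\ K (- (csqrt y - a), y).
  move=> fg ys.
  have e0 : segment_width (2 * a) y = 0 by rewrite /segment_width max_l//; lra.
  have e1 z : csqrt z = csqrt y -> segment_width a z = csqrt y - a.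
    by move=> zy; rewrite /segment_width zy max_r//; lra.
  have h1 := slice_le nK y; have := slice_le nK (- y).
  move: fg; rewrite /f /g e0 !e1 ?csqrtN// mulr0 adde0 => fg h2.
  (* Both slices obey the same upper bound and their sum attains twice that bound, so each of them
     attains it. *)
  have my : mu (ysection K y) = (2 * (csqrt y - a))%:E.
    apply/eqP; rewrite eq_le; apply/andP; split; first by rewrite -(e1 y).
    move: fg h2; rewrite -(e1 y)//.
    case: (mu (ysection K y)) => [r||]; case: (mu (ysection K (- y))) => [r'||] //=.
    by rewrite -EFinD => -[] h; rewrite !lee_fin; lra.
  have [] := @full_measure_ends (ysection K y) (csqrt y - a); last first.
  - by rewrite /ysection /= !inE.
  - exact: my.
  - lra.
  - move=> x; rewrite /ysection /= inE => /(normalized_le_csqrt nK).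
    by rewrite ler_norml in_itv.
  - by apply: closed_ysection; case: nK.
have cl (e : R) : closed [set y | K (e * (csqrt y - a), y)].
  apply: (@preimage_closed _ _ (fun y => (e * (csqrt y - a), y))); last by case: nK.
  move=> y _; apply: continuous_pair => z; last exact: cvg_id.
  apply: cvgM; first exact: cvg_cst.
  by apply: cvgB; [exact: continuous_csqrt|exact: cvg_cst].
have ae_up (P : R -> Prop) : (forall y, f y = g y -> P y) -> {ae mu, forall y, P y}.
  by move=> fgP; case: ae_fg => N [mN N0 sN]; exists N; split => // y nP; apply: sN => /fgP.
have arc y : a <= `|y| <= 2 * a -> K (csqrt y - a, y) /\ K (- (csqrt y - a), y).
  have up e : e = 1 \/ e = -1 -> forall y, a <= y <= 2 * a -> K (e * (csqrt y - a), y).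
    move=> ee; apply: (closed_ae_dense (cl e)); first lra.
    apply: ae_up => z fg zz; have [] := ends _ fg (csI' _ zz).
    by case: ee => ->; rewrite /= ?mul1r ?mulN1r.
  have dn e : e = 1 \/ e = -1 -> forall y, - (2 * a) <= y <= - a ->
      K (e * (csqrt y - a), y).
    move=> ee; apply: (closed_ae_dense (cl e)); first lra.
    apply: ae_up => z fg zz; have [] := ends _ fg.
      by rewrite -csqrtN; apply: csI'; lra.
    by case: ee => ->; rewrite /= ?mul1r ?mulN1r.
  move=> yy; have {yy}[yy|yy] : a <= y <= 2 * a \/ - (2 * a) <= y <= - a.
    by move: yy; case: (ler0P y) => y0 yy; [right|left]; lra.
  - have := up 1 (or_introl erefl) _ yy; have := up (-1) (or_intror erefl) _ yy.
    by rewrite mul1r mulN1r.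
  - have := dn 1 (or_introl erefl) _ yy; have := dn (-1) (or_intror erefl) _ yy.
    by rewrite mul1r mulN1r.
have vK := ncvx nK.
have a0 : 0 < a by lra.
have corner e e' : e = 1 \/ e = -1 -> e' = 1 \/ e' = -1 -> K (e * a, e' * a).
  move=> ee ee'.
  have ea : a <= `|e' * a| <= 2 * a.
    by rewrite normrM (gtr0_norm a0); case: ee' => ->; rewrite ?normrN ?normr1; lra.
  have [] := arc _ ea.
  have -> : csqrt (e' * a) - a = a.
    by case: ee' => ->; rewrite ?mulN1r ?mul1r ?csqrtN cs1; lra.
  by case: ee => ->; rewrite /= ?mul1r ?mulN1r.
have hseg x1 x2 x y : K (x1, y) -> K (x2, y) -> x1 <= x <= x2 -> K (x, y).
  move=> K1 K2 xx; have [e|ne] := eqVneq x1 x2; first by rewrite (_ : x = x1)//; lra.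
  have d0 : 0 < x2 - x1 by rewrite subr_gt0 lt_neqAle ne; lra.
  have := vK _ _ ((x - x1) / (x2 - x1)) K1 K2.
  rewrite divr_ge0 ?ler_pdivrMr//=; try lra.
  move=> h; have := h ltac:(lra); congr K; congr pair; by field; rewrite lt0r_neq0.
have vseg y1 y2 x y : K (x, y1) -> K (x, y2) -> y1 <= y <= y2 -> K (x, y).
  move=> K1 K2 xx; have [e|ne] := eqVneq y1 y2; first by rewrite (_ : y = y1)//; lra.
  have d0 : 0 < y2 - y1 by rewrite subr_gt0 lt_neqAle ne; lra.
  have := vK _ _ ((y - y1) / (y2 - y1)) K1 K2.
  rewrite divr_ge0 ?ler_pdivrMr//=; try lra.
  move=> h; have := h ltac:(lra); congr K; congr pair; by field; rewrite lt0r_neq0.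
apply/seteqP; split => [[x y] Kxy|[x y]].
  have lens := nlens nK Kxy.
  (* If [e * x] exceeded a, the segment from (x, y) to the corner of the square on the same side but
     across the axis would meet the axis beyond the end of the chord. *)
  have side e e' : e = 1 \/ e = -1 -> e' = 1 \/ e' = -1 -> 0 <= e' * y -> e * x <= a.
    move=> ee ee' y0; rewrite leNgt; apply/negP => xa.
    have Kc : K (e * a, - e' * a).
      by apply: corner => //; case: ee' => ->; [right|left]; rewrite ?opprK.
    have p0 : 0 < e' * y + a by lra.
    pose t := e' * y / (e' * y + a).
    have t1 : 0 <= t < 1 by rewrite /t divr_ge0 ?ltr_pdivrMr//=; lra.
    have := vK _ _ t Kxy Kc; rewrite /=.
    have -> : (1 - t) * y + t * (- e' * a) = 0.
      transitivity (y * a * (1 - e' * e') / (e' * y + a)).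
        by rewrite /t; field; rewrite lt0r_neq0.
      by case: ee' => ->; rewrite ?mulrNN mul1r subrr mulr0 mul0r.
    move=> h; have /(nchord nK) := h ltac:(lra).
    rewrite ler_norml => hh.
    suff : a < e * ((1 - t) * x + t * (e * a)) by case: ee hh => ->; lra.
    have -> : e * ((1 - t) * x + t * (e * a)) = (1 - t) * (e * x) + t * a * (e * e) by ring.
    have -> : e * e = 1 by case: ee => ->; rewrite ?mul1r ?mulrNN ?mul1r.
    nra.
  have xa : - a <= x <= a.
    have [e' ee' ye] : exists2 e' : R, e' = 1 \/ e' = -1 & 0 <= e' * y.
      by have [y0|y0] := leP 0 y; [exists 1; [left|lra]|exists (-1); [right|lra]].
    have := side 1 e' (or_introl erefl) ee' ye;
        have := side (-1) e' (or_intror erefl) ee' ye.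
    lra.
  rewrite /Qset /= -/halfwidth -/a; split => //.
    by case: (ler0P x) lens => x0 lens; nra.
  by case: (ler0P x) lens => x0 lens; nra.
rewrite /Qset /= -/halfwidth -/a => -[xa q1 q2].
have lens : (`|x| + a) ^+ 2 + y ^+ 2 <= 1.
  case: (ler0P x) => x0 //.
  by rewrite (_ : (- x + a) ^+ 2 = (x - a) ^+ 2)//; ring.
(* From height a on, the slices of Q end on the arcs; below it they are those of the square. *)
have [ya|ya] := leP a `|y|.
  have yb : `|y| <= 2 * a by case: (ler0P y) ya => y0 ya; have := normr_ge0 x; nra.
  have [K1 K2] := arc y ltac:(lra).
  apply: (hseg _ _ _ _ K2 K1); rewrite -ler_norml.
  rewrite lerBrDr -[leLHS]ger0_norm; last by have := normr_ge0 x; lra.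
  by rewrite -sqrtr_sqr; apply: ler_wsqrtr; lra.
have yb : -1 * a <= y <= 1 * a by move: ya; rewrite ltr_norml; lra.
have one1 : (1 : R) = 1 \/ (1 : R) = -1 by left.
have onem : (-1 : R) = 1 \/ (-1 : R) = -1 by right.
apply: (hseg (-1 * a) (1 * a)); last lra.
  exact: (vseg _ _ _ _ (corner _ _ onem onem) (corner _ _ onem one1) yb).
exact: (vseg _ _ _ _ (corner _ _ one1 onem) (corner _ _ one1 one1) yb).
Qed.
End equality.

(** * From dividing curves to dividing lines *)

Section plane.
Context {R : realType}.
Implicit Types (p q z w x y : R * R) (K F : set (R * R)).

Definition dist2 p q : R := (p.1 - q.1) ^+ 2 + (p.2 - q.2) ^+ 2.

Lemma dist2_ge0 p q : 0 <= dist2 p q.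
Proof. by rewrite addr_ge0 ?sqr_ge0. Qed.

Lemma euclid_le p q (D : R) : 0 <= D -> (edist p q <= D) = (dist2 p q <= D ^+ 2).
Proof.
move=> D0; rewrite /edist -/(dist2 p q) -[X in _ <= X](ger0_norm D0) -sqrtr_sqr ler_sqrt//.
exact: sqr_ge0.
Qed.

Lemma euclid_ge0 p q : 0 <= edist p q. Proof. exact: sqrtr_ge0. Qed.

Lemma euclidC p q : edist p q = edist q p.
Proof. rewrite /Defs.edist; congr Num.sqrt; ring. Qed.

(** Convexity of discs, by Stewart's identity for the point that divides pq in the ratio t : 1 -
    t. *)
Lemma euclid_conv p q z (t D : R) : 0 <= t <= 1 -> edist p z <= D -> edist q z <= D ->
  edist ((1 - t) * p.1 + t * q.1, (1 - t) * p.2 + t * q.2) z <= D.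
Proof.
move=> tt h; have D0 : 0 <= D := le_trans (euclid_ge0 _ _) h.
rewrite euclid_le// in h; rewrite !euclid_le// => h2.
have -> : dist2 ((1 - t) * p.1 + t * q.1, (1 - t) * p.2 + t * q.2) z =
  (1 - t) * dist2 p z + t * dist2 q z - t * (1 - t) * dist2 p q by rewrite /dist2 /=; ring.
have h3 : 0 <= t * (1 - t) * dist2 p q by rewrite !mulr_ge0// ?dist2_ge0//; lra.
have h4 : (1 - t) * dist2 p z <= (1 - t) * D ^+ 2 by apply: ler_wpM2l => //; lra.
have h5 : t * dist2 q z <= t * D ^+ 2 by apply: ler_wpM2l => //; lra.
lra.
Qed.

Lemma convex_set_cvx K : convex_set K -> cvx K.
Proof.
move=> cK p q t Kp Kq tt.
have h0 : 0 <= 1 - t by lra.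
have h1 : 1 - t <= 1 by lra.
have := cK p q (Itv01 h0 h1).
rewrite !inE => /(_ Kp Kq).
by congr K; rewrite /conv /= /GRing.scale /= /scale_pair /GRing.scale /= /unstable.onem
    subKr; congr pair.
Qed.

Lemma compact_bounded2 K : compact K ->
  exists M : R, forall z, K z -> `|z.1| <= M /\ `|z.2| <= M.
Proof.
move=> /compact_bounded [M [_ hM]].
exists (M + 1) => z Kz; have M1 : M < M + 1 by rewrite ltrDl ltr01.
by have := hM _ M1 z Kz; rewrite /= prod_normE /= ge_max => /andP[].
Qed.

Lemma le_diam F p q : (exists M : R, forall z, F z -> `|z.1| <= M /\ `|z.2| <= M) ->
  F p -> F q -> edist p q <= diam F.
Proof.
move=> [M hM] Fp Fq; apply: ub_le_sup; last by exists p => //; exists q.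
have M0 : 0 <= M by have [h _] := hM _ Fp; exact: le_trans h.
exists (4 * M) => _ [z Fz [w Fw <-]].
have [z1 z2] := hM _ Fz; have [w1 w2] := hM _ Fw.
rewrite euclid_le ?mulr_ge0// /dist2.
move: z1 z2 w1 w2; rewrite !ler_norml => z1 z2 w1 w2.
have sq (d : R) : - (2 * M) <= d <= 2 * M -> d ^+ 2 <= (2 * M) ^+ 2.
  move=> dM; rewrite -subr_ge0 (_ : _ - _ = (2 * M - d) * (2 * M + d)); last by ring.
  by apply: mulr_ge0; lra.
have a1 : (z.1 - w.1) ^+ 2 <= (2 * M) ^+ 2 by apply: sq; lra.
have a2 : (z.2 - w.2) ^+ 2 <= (2 * M) ^+ 2 by apply: sq; lra.
have a3 : 0 <= M ^+ 2 by exact: sqr_ge0.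
apply: (le_trans (lerD a1 a2)); rewrite !exprMn; lra.
Qed.

(** Twice the signed area of the triangle pqz; positive when z is to the left of the line directed
    from p to q. *)
Definition cross p q z : R := (q.1 - p.1) * (z.2 - p.2) - (q.2 - p.2) * (z.1 - p.1).

Lemma continuous_cross p q : continuous (cross p q).
Proof.
move=> z; apply: cvgB; apply: cvgM; try exact: cvg_cst.
  by apply: cvgB; [exact: cvg_snd|exact: cvg_cst].
by apply: cvgB; [exact: cvg_fst|exact: cvg_cst].
Qed.

(** Divided by [cross p q z], the three cross products are the barycentric coordinates of w, so the
    open triangle is an open subset of K. Since [cvx] combines two points at a time, w is reached
    through a point of the segment pz. *)
Lemma triangle_interior K p q z w : cvx K -> K p -> K q -> K z ->
  0 < cross p q z -> 0 < cross p q w -> 0 < cross q z w -> 0 < cross z p w -> K° w.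
Proof.
move=> vK Kp Kq Kz d0 c1 c2 c3.
pose U := [set w | 0 < cross p q w] `&` [set w | 0 < cross q z w] `&` [set w | 0 <
    cross z p w].
have oU : open U.
  have o1 a b : open [set w | 0 < cross a b w].
    apply: (@open_comp _ _ (cross a b) [set x | 0 < x]).
      by move=> x _; exact: continuous_cross.
    exact: open_gt.
  by do 2 apply: openI => //.
have : nbhs w U by apply: open_nbhs_nbhs; split.
apply: filterS => {c1 c2 c3}w [[/= c1 c2] c3].
have sum : cross p q w + cross q z w + cross z p w = cross p q z by rewrite /cross; ring.
pose s := cross p q w + cross q z w.
have s0 : 0 < s by rewrite addr_gt0.
pose y := ((1 - cross p q w / s) * p.1 + cross p q w / s * z.1, (1 - cross p q w / s) *
    p.2 + cross p q w / s * z.2).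
have Ky : K y.
  by apply: vK => //; rewrite divr_ge0 ?ler_pdivrMr /s; lra.
have := vK y q (cross z p w / cross p q z) Ky Kq.
rewrite divr_ge0 ?ler_pdivrMr; try lra.
move=> /(_ ltac:(lra)).
have e1 : 1 - cross z p w / cross p q z = s / cross p q z.
  by rewrite (_ : s = cross p q z - cross z p w); [field; lra|rewrite /s; lra].
rewrite e1 /y /=.
have d1 : cross p q z != 0 by lra.
have s1 : s != 0 by lra.
suff [-> ->] : s / cross p q z * ((1 - cross p q w / s) * p.1 + cross p q w / s * z.1) +
      cross z p w / cross p q z * q.1 = w.1 /\
    s / cross p q z * ((1 - cross p q w / s) * p.2 + cross p q w / s * z.2) +
      cross z p w / cross p q z * q.2 = w.2 by case: (w).
have e2 a b c : s / cross p q z * ((1 - cross p q w / s) * a + cross p q w / s * b) +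
      cross z p w / cross p q z * c =
      (cross q z w * a + cross p q w * b + cross z p w * c) / cross p q z.
  have -> : cross q z w = s - cross p q w by rewrite /s; ring.
  by field; rewrite d1.
rewrite !e2; split; apply: (mulIf d1); rewrite divfK// /cross; ring.
Qed.
End plane.

(** * Boundary points of a convex set on one side of a line *)

Section sides.
Context {R : realType}.
Implicit Types (p q z w x y v : R * R) (K F : set (R * R)).

Definition bounded2 K := exists M : R, forall z, K z -> `|z.1| <= M /\ `|z.2| <= M.

Definition ray x v (t : R) : R * R := (x.1 + t * v.1, x.2 + t * v.2).

Lemma continuous_ray x v : continuous (ray x v).
Proof.
by apply: continuous_pair => t; apply: cvgD; try exact: cvg_cst; apply: cvgM;
  try exact: cvg_cst; exact: cvg_id.
Qed.

(** The last time at which the ray is in K exists because K is closed and bounded and v is nonzero;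
    from an interior point the ray could go on. *)
Lemma exit_point K x v : closed K -> bounded2 K -> v.1 != 0 \/ v.2 != 0 -> K x ->
  exists t, [/\ 0 <= t, K (ray x v t) & ~ K° (ray x v t)].
Proof.
move=> cK [M hM] v0 Kx.
pose T := [set t | 0 <= t /\ K (ray x v t)].
have T0 : T 0 by split => //; rewrite /ray !mul0r !addr0; case: (x) Kx.
have bound (a b t : R) : b != 0 -> `|a| <= M -> `|a + t * b| <= M -> t <= 2 * M / `|b|.
  move=> b0 aM abM; rewrite ler_pdivlMr ?normr_gt0//.
  apply: (@le_trans _ _ `|t * b|); first by rewrite normrM ler_wpM2r// ler_norm.
  have -> : t * b = (a + t * b) - a by ring.
  by apply: (le_trans (ler_normB _ _)); lra.
have [B hB] : exists B, ubound T B.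
  have [x1 x2] := hM _ Kx.
  case: v0 => v0.
    by exists (2 * M / `|v.1|) => t [t0 /hM [/= h1 h2]]; exact: bound h1.
  by exists (2 * M / `|v.2|) => t [t0 /hM [/= h1 h2]]; exact: bound h2.
have cT : closed T.
  apply: closedI; first exact: closed_ge.
  by apply: preimage_closed => // t _; exact: continuous_ray.
have Ts : T (sup T) by apply: cT; apply: closure_sup; [exists 0|exists B].
case: Ts => s0 Ks; exists (sup T); split => // /(@continuous_ray x v).
move=> /nbhs_ballP[e /= e0 be].
have : T (sup T + e / 2).
  split; first by lra.
  by apply: be; rewrite -ball_normE /= opprD addrA subrr sub0r normrN gtr0_norm; lra.
move=> /ub_le_sup h; have := h (ex_intro _ B hB); lra.
Qed.

Lemma cross_ray p q x t : cross p q (ray x (q.1 - p.1, q.2 - p.2) t) = cross p q x.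
Proof. by rewrite /cross /ray /=; ring. Qed.

(* A point on the positive side of pq lies on a chord parallel to pq, whose ends
   are boundary points on the same side. *)
Lemma side_diam K F p q : closed K -> bounded2 K -> p.1 != q.1 \/ p.2 != q.2 -> F `<=` K ->
  (forall z, K z -> ~ K° z -> 0 < cross p q z -> F z) ->
  forall x y, K x -> K y -> 0 < cross p q x -> 0 < cross p q y -> edist x y <= diam F.
Proof.
move=> cK bK pq FK arcF.
have FD x y : F x -> F y -> edist x y <= diam F.
  by apply: le_diam; case: bK => M hM; exists M => z /FK/hM.
have chord x z D : K x -> 0 < cross p q x ->
    (forall a, F a -> edist a z <= D) -> edist x z <= D.
  move=> Kx cx FDz.
  pose v := (q.1 - p.1, q.2 - p.2).
  pose v' := (p.1 - q.1, p.2 - q.2).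
  have [t [t0 Kt Bt]] : exists t, [/\ 0 <= t, K (ray x v t) & ~ K° (ray x v t)].
    by apply: exit_point => //; case: pq => h; [left|right]; rewrite /= subr_eq0 eq_sym.
  have [s [s0 Ks Bs]] : exists t, [/\ 0 <= t, K (ray x v' t) & ~ K° (ray x v' t)].
    by apply: exit_point => //; rewrite /= !subr_eq0.
  have Fa : F (ray x v t) by apply: arcF => //; rewrite cross_ray.
  have Fb : F (ray x v' s).
    apply: arcF => //.
    have -> : ray x v' s = ray x v (- s) by rewrite /ray /=; congr pair; ring.
    by rewrite cross_ray.
  (* If s = 0 then x is itself a boundary point; otherwise it divides the chord in the ratio s :
     t. *)
  have [s00|sn0] := eqVneq s 0.
    have := FDz _ Fb; rewrite s00 /ray !mul0r !addr0; by case: (x).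
  have sp : 0 < s + t by rewrite ltr_pwDl// lt_neqAle eq_sym sn0.
  have -> : x = ((1 - s / (s + t)) * (ray x v' s).1 + s / (s + t) * (ray x v t).1,
                 (1 - s / (s + t)) * (ray x v' s).2 + s / (s + t) * (ray x v t).2).
    by rewrite /ray /=; case: (x) => x1 x2 /=; congr pair; field; rewrite lt0r_neq0.
  apply: euclid_conv; [|exact: FDz|exact: FDz].
  by rewrite divr_ge0 ?ler_pdivrMr//=; lra.
move=> x y Kx Ky cx cy; apply: (chord _ _ _ Kx cx) => a Fa; rewrite euclidC.
by apply: (chord _ _ _ Ky cy) => b Fb; exact: FD.
Qed.

(* Seen from the midpoint o of pq, the arc on the positive side of pq is a graph
   over the directions between two of its points, so splitting it into two closed
   pieces would disconnect [0, 1]. *)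
Lemma one_side K F1 F2 p q : closed K -> bounded2 K -> cvx K -> K p -> K q ->
  closed F1 -> closed F2 -> K `<=` F1 `|` F2 ->
  (forall z, K z -> ~ K° z -> 0 < cross p q z -> F1 z -> F2 z -> False) ->
  (forall z, K z -> ~ K° z -> 0 < cross p q z -> F1 z) \/
  (forall z, K z -> ~ K° z -> 0 < cross p q z -> F2 z).
Proof.
move=> cK bK vK Kp Kq cF1 cF2 KF dis.
apply: contrapT => /not_orP[/existsNP[y hy] /existsNP[x hx]].
move: hx => /not_implyP[Kx /not_implyP[Bx /not_implyP[cx F2x]]].
move: hy => /not_implyP[Ky /not_implyP[By /not_implyP[cy F1y]]].
have F1x : F1 x by case: (KF _ Kx).
have F2y : F2 y by case: (KF _ Ky).
pose o : R * R := ((p.1 + q.1) / 2, (p.2 + q.2) / 2).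
(* [tau] picks a point of the segment xy and [t] scales it from o. As o lies on the line pq,
   [cross p q] is linear in [t]. *)
pose P (tau t : R) : R * R := (o.1 + t * ((1 - tau) * (x.1 - o.1) + tau * (y.1 - o.1)),
                 o.2 + t * ((1 - tau) * (x.2 - o.2) + tau * (y.2 - o.2))).
have crossP tau t : cross p q (P tau t) = t * ((1 - tau) * cross p q x + tau * cross p q y).
  by rewrite /cross /P /o /=; field.
pose m := Num.min (cross p q x) (cross p q y).
have m0 : 0 < m by rewrite lt_min cx.
have slope tau : 0 <= tau <= 1 -> m <= (1 - tau) * cross p q x + tau * cross p q y.
  move=> tt; have mx : m <= cross p q x by rewrite ge_min lexx.
  have my : m <= cross p q y by rewrite ge_min lexx orbT.
  have h1 : (1 - tau) * m <= (1 - tau) * cross p q x by apply: ler_wpM2l => //; lra.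
  have h2 : tau * m <= tau * cross p q y by apply: ler_wpM2l => //; lra.
  lra.
(* For s < t the point [P tau s] is inside the triangle p, q, [P tau t], since o is the midpoint of
   pq. Hence each direction has at most one boundary point. *)
have below tau s t : 0 <= tau <= 1 -> 0 < s < t -> K (P tau t) -> K° (P tau s).
  move=> tt st KP; have sl := slope _ tt.
  set f := (1 - tau) * cross p q x + tau * cross p q y in sl.
  have f0 : 0 < f by exact: lt_le_trans sl.
  have [s0 t0] : 0 < s /\ 0 < t by lra.
  have ts0 : 0 < t - s by lra.
  apply: (@triangle_interior _ _ p q (P tau t)) => //.
  - by rewrite crossP mulr_gt0.
  - by rewrite crossP mulr_gt0.
  - have -> : cross q (P tau t) (P tau s) = (t - s) * f / 2.
      by rewrite /f /cross /P /o /=; field.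
    by rewrite !mulr_gt0 ?invr_gt0.
  - have -> : cross (P tau t) p (P tau s) = (t - s) * f / 2.
      by rewrite /f /cross /P /o /=; field.
    by rewrite !mulr_gt0 ?invr_gt0.
have uniq tau s t : 0 <= tau <= 1 -> 0 < s -> 0 < t -> K (P tau s) -> ~ K° (P tau s) ->
    K (P tau t) -> ~ K° (P tau t) -> s = t.
  move=> tt s0 t0 Ks Bs Kt Bt; case: (ltgtP s t) => // st.
    by exfalso; apply: Bs; apply: (below tau s t) => //; rewrite s0.
  by exfalso; apply: Bt; apply: (below tau t s) => //; rewrite t0.
have Bx1 : P 0 1 = x by rewrite /P; case: (x) => ? ? /=; congr pair; ring.
have By1 : P 1 1 = y by rewrite /P; case: (y) => ? ? /=; congr pair; ring.
have ex tau : 0 <= tau <= 1 -> exists t, [/\ 1 <= t, K (P tau t) & ~ K° (P tau t)].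
  move=> tt; pose v := ((1 - tau) * (x.1 - o.1) + tau * (y.1 - o.1),
                        (1 - tau) * (x.2 - o.2) + tau * (y.2 - o.2)).
  have PE t : P tau t = ray (P tau 1) v (t - 1) by rewrite /P /ray /=; congr pair; ring.
  have KP1 : K (P tau 1).
    by have := vK _ _ tau Kx Ky tt; congr K; rewrite /P /=; congr pair; ring.
  have v0 : v.1 != 0 \/ v.2 != 0.
    apply: contrapT => /not_orP[/negP + /negP]; rewrite !negbK /v /= => /eqP v1 /eqP v2.
    have : cross p q (P tau 1) = 0.
      by rewrite /P v1 v2 /cross /o /=; field.
    by rewrite crossP mul1r; have := slope _ tt; lra.
  have [t [t0 Kt Bt]] := exit_point cK bK v0 KP1.
  by exists (t + 1); split; [lra|rewrite PE addrK|rewrite PE addrK].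
(* On K the cross product is bounded, and it is at least [t * m]. The bound on [t] makes the
   parameter set compact. *)
have [M [M1 hM]] : exists M, 1 <= M /\ forall tau t, 0 <= tau <= 1 -> K (P tau t) -> t <= M.
  have [M0 hM] := bK.
  pose B := `|q.1 - p.1| * (M0 + `|p.2|) + `|q.2 - p.2| * (M0 + `|p.1|).
  exists (Num.max 1 (B / m)); split; first by rewrite le_max lexx.
  move=> tau t tt Kt; rewrite le_max; apply/orP.
  have [t0|t0] := leP t 0; [left; lra|right].
  rewrite ler_pdivlMr//; apply: (@le_trans _ _ (cross p q (P tau t))).
    by rewrite crossP; apply: ler_wpM2l; [lra|exact: slope].
  have [h1 h2] := hM _ Kt; move: (P tau t) h1 h2 => w h1 h2.
  apply: (le_trans (ler_norm _)); apply: (le_trans (ler_normB _ _)).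
  by rewrite !normrM; apply: lerD; apply: ler_wpM2l => //;
     apply: (le_trans (ler_normB _ _)); rewrite lerD2r.
(* The directions whose boundary point lies in F; being the projection of a compact set, this set is
   closed. *)
pose T F := fst @` [set c : R * R | (0 <= c.1 <= 1) /\ (1 <= c.2 <= M) /\
   K (P c.1 c.2) /\ ~ K° (P c.1 c.2) /\ F (P c.1 c.2)].
have cT F : closed F -> closed (T F).
  move=> cF; apply: compact_closed; first exact: Rhausdorff.
  apply: continuous_compact.
    by apply: continuous_subspaceT => c; exact: cvg_fst.
  have cP : continuous (fun c : R * R => P c.1 c.2).
    have c1 : continuous (fun c : R * R => c.1) by move=> c; exact: cvg_fst.
    have c2 : continuous (fun c : R * R => c.2) by move=> c; exact: cvg_snd.
    have aux (a b d : R) : continuous (fun c : R * R => a + c.2 * ((1 - c.1) * b + c.1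
        * d)).
      move=> c; apply: cvgD; first exact: cvg_cst.
      apply: cvgM; first exact: c2.
      apply: cvgD; apply: cvgM; [|exact: cvg_cst|exact: c1|exact: cvg_cst].
      by apply: cvgB; [exact: cvg_cst|exact: c1].
    by apply: continuous_pair; exact: aux.
  have -> : [set c : R * R | (0 <= c.1 <= 1) /\ (1 <= c.2 <= M) /\
      K (P c.1 c.2) /\ ~ K° (P c.1 c.2) /\ F (P c.1 c.2)] =
    (`[0, 1] `*` `[1, M]) `&` (fun c : R * R => P c.1 c.2) @^-1` (K `&` ~` K° `&` F).
    apply/seteqP; split => -[c1 c2] /=; rewrite !in_itv /=; tauto.
  apply: compact_closedI; first by apply: compact_setX; exact: segment_compact.
  apply: preimage_closed; first by move=> c _; exact: cP.
  by apply: closedI => //; apply: closedI => //; apply: open_closedC; exact: open_interior.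
have cov tau : 0 <= tau <= 1 -> T F1 tau \/ T F2 tau.
  move=> tt; have [t [t1 Kt Bt]] := ex _ tt.
  have tM := hM _ _ tt Kt.
  by case: (KF _ Kt) => Ft; [left|right]; exists (tau, t) => //; do ! split => //;
      rewrite t1.
have disj tau : T F1 tau -> T F2 tau -> False.
  move=> [[tau1 t] /= [tt [tM [Kt [Bt F1t]]]] <-] [[tau2 s] /= [ss [sM [Ks [Bs F2s]]]] e].
  subst tau2; have st : s = t by apply: (uniq tau1) => //; lra.
  subst s; apply: (dis (P tau1 t)) => //.
  by rewrite crossP mulr_gt0//; have := slope _ tt; lra.
have T1x : T F1 0.
  exists (0, 1) => //=; rewrite Bx1; do ! split => //; lra.
have T2y : T F2 1.
  exists (1, 1) => //=; rewrite By1; do ! split => //; lra.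
have T01 F tau : T F tau -> 0 <= tau <= 1 by move=> [[? ?] /= [? _] <-].
have c01 : connected (`[0, 1]%classic : set R).
  by apply/connected_intervalP; exact: interval_is_interval.
have T1E : T F1 = `[0, 1]%classic.
  apply: c01; first by exists 0.
    exists (~` T F2); first by apply: closed_openC; exact: cT.
    apply/seteqP; split => tau /=; rewrite in_itv /=.
      by move=> h; split; [exact: T01 h|move=> h2; exact: disj h h2].
    by move=> [tt nT2]; case: (cov _ tt).
  exists (T F1); first exact: cT.
  by apply/seteqP; split => tau /=; rewrite in_itv /=; [move=> h; split => //;
      exact: T01 h|case].
apply: (disj 1) => //; rewrite T1E /= in_itv /=; lra.
Qed.

End sides.

(** * Dividing lines from bisections, and their limits *)

Section halving.
Context {R : realType}.
Implicit Types (p q z w x y v u : R * R) (K F : set (R * R)).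

Definition dot u z : R := u.1 * z.1 + u.2 * z.2.

(** Strict inequalities make the condition on a pair of points open in (u, c), as the limit argument
    requires. Points on the line are treated later, by [halved_axis_dist2]. *)
Definition halved K (D : R) u (c : R) := forall x y, K x -> K y ->
  (c < dot u x -> c < dot u y -> edist x y <= D) /\
  (dot u x < c -> dot u y < c -> edist x y <= D).

Lemma halved_le K D D' u c : D <= D' -> halved K D u c -> halved K D' u c.
Proof.
move=> DD h x y Kx Ky; have [h1 h2] := h x y Kx Ky.
by split=> cx cy; [apply: le_trans (h1 cx cy) DD|apply: le_trans (h2 cx cy) DD].
Qed.

(** The pieces share no boundary point of K except the ends p, q of the curve, so [one_side] and
    [side_diam] apply on both sides of the line pq. Both arcs may fall into the same piece, which
    the maximum allows. The point of K on the line keeps the offset bounded. *)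
Lemma bisection_halved K B : convex_body K -> bisection K B ->
  exists u c, [/\ dot u u = 1, exists2 p, K p & dot u p = c &
    halved K (Num.max (diam B.1) (diam B.2)) u c].
Proof.
move=> [compK convK _] [c1 c2 KB [l [[_ linj lK lbd] BI]]].
have cK : closed K by apply: compact_closed => //; exact: norm_hausdorff.
have bK : bounded2 K := compact_bounded2 compK.
have vK := convex_set_cvx convK.
pose p := l (-1); pose q := l 1.
have Im : (`[(-1 : R), 1]%classic : set R) (-1) by rewrite /= in_itv /= lexx ge0_cp.
have I1 : (`[(-1 : R), 1]%classic : set R) 1 by rewrite /= in_itv /= lexx andbT ge0_cp.
have Kp : K p by apply: lK; exists (-1).
have Kq : K q by apply: lK; exists 1.
have B1K : B.1 `<=` K by rewrite KB; apply: subsetUl.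
have B2K : B.2 `<=` K by rewrite KB; apply: subsetUr.
have dis z : K z -> ~ K° z -> B.1 z -> B.2 z -> z = p \/ z = q.
  move=> Kz Bz b1 b2; have : (B.1 `&` B.2) z by split.
  rewrite BI => lz; have : [set l (-1); l 1] z.
    by rewrite -lbd; split => //; split => //; exact: subset_closure.
  by case => ->; [left|right].
have KU : K `<=` B.1 `|` B.2 by rewrite {1}KB.
have pq : p != q.
  apply/eqP => /linj; rewrite !inE => /(_ Im I1) e.
  by have := @ltrN10 R; rewrite e ltr10.
clear BI lbd KB.
have N0 : 0 < dist2 p q.
  rewrite lt_neqAle dist2_ge0 andbT eq_sym; apply: contra pq.
  rewrite /dist2 paddr_eq0 ?sqr_ge0// !sqrf_eq0 !subr_eq0 => /andP[/eqP e1 /eqP e2].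
  by move: e1 e2; case: (p) (q) => [? ?] [? ?] /= -> ->.
have pq' (a b : R * R) : a != b -> a.1 != b.1 \/ a.2 != b.2.
  move=> ab; apply: contrapT => /not_orP[/negP + /negP]; rewrite !negbK => /eqP e1 /eqP e2.
  by move/eqP: ab; apply; move: e1 e2; case: (a) (b) => [? ?] [? ?] /= -> ->.
pose N : R := Num.sqrt (dist2 p q).
have N1 : 0 < N by rewrite sqrtr_gt0.
have N2 : N ^+ 2 = dist2 p q by rewrite sqr_sqrtr// ltW.
(* The unit normal to pq for which [dot u z - dot u p] is the cross product divided by the length of
   pq. *)
pose u := (- (q.2 - p.2) / N, (q.1 - p.1) / N).
have uE z : dot u z - dot u p = cross p q z / N by rewrite /dot /u /cross /=; field; lra.
have main a b : a != b -> K a -> K b -> (a = p /\ b = q) \/ (a = q /\ b = p) ->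
    forall x y, K x -> K y -> 0 < cross a b x -> 0 < cross a b y ->
    edist x y <= Num.max (diam B.1) (diam B.2).
  move=> ab Ka Kb abpq x y Kx Ky cx cy; rewrite le_max.
  have [|h|h] := @one_side _ K B.1 B.2 a b cK bK vK Ka Kb c1 c2 KU.
  - move=> z Kz Bz cz b1 b2.
    have ca : cross a b a = 0 by rewrite /cross; ring.
    have cb : cross a b b = 0 by rewrite /cross; ring.
    have zab : z = a \/ z = b.
      by have := dis z Kz Bz b1 b2; case: abpq => -[-> ->] [] ->; tauto.
    by case: zab cz => ->; rewrite ?ca ?cb ltxx.
  - by rewrite (@side_diam _ K B.1 a b)//; exact: pq'.
  - by rewrite (@side_diam _ K B.2 a b) ?orbT//; exact: pq'.
exists u, (dot u p); split.
- rewrite /dot /u /= (_ : _ + _ = dist2 p q / N ^+ 2); last by rewrite /dist2; field; lra.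
  by rewrite N2 divff//; lra.
- by exists p.
have pos z : (dot u p < dot u z) = (0 < cross p q z).
  by rewrite -subr_gt0 uE pmulr_lgt0// invr_gt0.
have neg z : (dot u z < dot u p) = (0 < cross q p z).
  rewrite -subr_lt0 uE pmulr_llt0 ?invr_gt0// -oppr_gt0.
  by congr (_ < _); rewrite /cross; ring.
move=> x y Kx Ky; split; rewrite ?pos ?neg => cx cy.
  by apply: (main p q) => //; left.
by apply: (main q p) => //; [rewrite eq_sym|right].
Qed.

Lemma diam_ge0 F : 0 <= diam F.
Proof.
rewrite /diam; set S := (X in sup X).
(* Outside its domain [sup] takes the default value 0. *)
have [hs|hs] := pselect (has_sup S); last by rewrite sup_out.
case: (hs) => -[r [p Fp [q Fq _]]] ub. apply: (le_trans (euclid_ge0 p q)).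
by apply: ub_le_sup => //; exists p => //; exists q.
Qed.

Lemma continuous_dot z : continuous (fun s : R * R * R => dot s.1 z - s.2).
Proof.
have c1 : continuous (fun s : R * R * R => s.1.1).
  by move=> s; apply: (@continuous_comp _ _ _ fst fst); exact: cvg_fst.
have c2 : continuous (fun s : R * R * R => s.1.2).
  by move=> s; apply: (@continuous_comp _ _ _ fst snd); [exact: cvg_fst|exact: cvg_snd].
move=> s; apply: cvgB; last exact: cvg_snd.
by apply: cvgD; apply: cvgM; try exact: cvg_cst; [exact: c1|exact: c2].
Qed.

Lemma dot_coord_le u : dot u u = 1 -> `|u.1| <= 1 /\ `|u.2| <= 1.
Proof.
rewrite /dot => uu; have sq (a b : R) : a * a + b * b = 1 -> `|a| <= 1.
  by move=> ab; rewrite ler_norml; apply/andP; split; nra.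
by split; [exact: sq uu|apply: (sq _ u.1); rewrite addrC].
Qed.

(** Bisections within 1 / (n + 1) of the infimum give lines in a compact parameter set; any cluster
    point works. *)
Lemma DB_halved K : convex_body K -> bisection K !=set0 ->
  exists u c, dot u u = 1 /\ halved K (DB K) u c.
Proof.
move=> bK [B0 hB0].
have [compK _ _] := bK.
have [M hM] := compact_bounded2 compK.
pose V := [set Num.max (diam B.1) (diam B.2) | B in bisection K].
have hi : has_inf V.
  split; first by exists (Num.max (diam B0.1) (diam B0.2)); exists B0.
  by exists 0 => _ [B _ <-]; rewrite le_max diam_ge0.
have step n : exists s : R * R * R, [/\ dot s.1 s.1 = 1, `|s.2| <= M + M &
    halved K (DB K + n.+1%:R^-1) s.1 s.2].
  have e0 : 0 < n.+1%:R^-1 :> R by rewrite invr_gt0.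
  have [_ [B hB <-] hlt] := inf_adherent e0 hi.
  have [u [c [uu [p Kp pc] hu]]] := bisection_halved bK hB.
  exists (u, c); split => //=; last exact: halved_le (ltW hlt) hu.
  have [u1 u2] := dot_coord_le uu; have [p1 p2] := hM _ Kp.
  rewrite -pc /dot; apply: (le_trans (ler_normD _ _)).
  by rewrite !normrM; apply: lerD; rewrite -[leRHS]mul1r; apply: ler_pM.
have [s hs] := choice step.
have compA : compact ((`[-1, 1] `*` `[-1, 1]) `*` `[- (M + M), M + M] : set (R * R * R)).
  by apply: compact_setX; [apply: compact_setX|]; exact: segment_compact.
have [|[u c] [_ cl]] := compA (s @ \oo).
  exists 0%N => // n _; have [uu cc _] := hs n.
  have [u1 u2] := dot_coord_le uu.
  by split; [split|]; rewrite /= in_itv /= -ler_norml.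
(* A neighborhood of the cluster point is visited at arbitrarily late indices, where the error 1 /
   (n + 1) is as small as desired. *)
have near (U : set (R * R * R)) : open U -> U (u, c) -> forall N, exists2 n, (N <= n)%N
    & U (s n).
  move=> oU Uc N.
  have [] := cl (s @` [set n | (N <= n)%N]) U.
  - by exists N => // n Nn; exists n.
  - by apply: open_nbhs_nbhs.
  by move=> _ [[n Nn <-] Un]; exists n.
have opn (f : R * R * R -> R) : continuous f -> open [set s | 0 < f s].
  move=> cf; apply: (@open_comp _ _ f [set x | 0 < x]); last exact: open_gt.
  by move=> x _; exact: cf.
have small (a b : R) : (forall N, exists2 n, (N <= n)%N & a <= b + n.+1%:R^-1) -> a <= b.
  move=> h; apply/ler_addgt0Pr => e e0.
  have [N _ hN] := near_infty_natSinv_lt (PosNum e0).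
  have [n Nn hn] := h N; apply: (le_trans hn); rewrite lerD2l.
  by apply: ltW; exact: (hN n Nn).
exists u, c; split.
  apply/eqP; rewrite -subr_eq0; apply/negPn/negP => ne.
  have cf : continuous (fun s : R * R * R => (dot s.1 s.1 - 1) ^+ 2).
    have c1 : continuous (fun s : R * R * R => s.1.1).
      by move=> t; apply: (@continuous_comp _ _ _ fst fst); exact: cvg_fst.
    have c2 : continuous (fun s : R * R * R => s.1.2).
      by move=> t; apply: (@continuous_comp _ _ _ fst snd); [exact: cvg_fst|exact: cvg_snd].
    have c3 : continuous (fun s : R * R * R => dot s.1 s.1 - 1).
      move=> t; apply: cvgB; last exact: cvg_cst.
      by apply: cvgD; apply: cvgM; [exact: c1|exact: c1|exact: c2|exact: c2].
    by move=> t; apply: cvgM; exact: c3.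
  have [|n _] := near _ (opn _ cf) _ 0%N; first by rewrite /= exprn_even_gt0.
  by have [uu _ _] := hs n; rewrite /= uu subrr expr0n /= ltxx.
move=> x y Kx Ky; split => cx cy; apply: small => N.
- have [|n Nn [/= n1 n2]] := near _ (openI (opn _ (@continuous_dot x)) (opn _
    (@continuous_dot y))) _ N.
    by split; rewrite /= subr_gt0.
  exists n => //; have [_ _ h] := hs n; apply: (h x y Kx Ky).1; rewrite -subr_gt0//.
- have cN z : continuous (fun s : R * R * R => - (dot s.1 z - s.2)).
    by move=> t; apply: cvgN; exact: continuous_dot.
  have [|n Nn [/= n1 n2]] := near _ (openI (opn _ (cN x)) (opn _ (cN y))) _ N.
    by split; rewrite /= opprB subr_gt0.
  exists n => //; have [_ _ h] := hs n; apply: (h x y Kx Ky).2;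
      rewrite -subr_gt0 -opprB; [exact: n1|exact: n2].
Qed.
End halving.

(** * Normal position *)

Section normalization.
Context {R : realType}.
Implicit Types (p q z w v u : R * R) (K F : set (R * R)).

Lemma continuous_affine (p q t1 r s t2 : R) : continuous (affine p q t1 r s t2).
Proof.
have aux (a b c : R) : continuous (fun z : R * R => a * z.1 + b * z.2 + c).
  move=> z; apply: cvgD; last exact: cvg_cst.
  by apply: cvgD; apply: cvgM; try exact: cvg_cst; [exact: cvg_fst|exact: cvg_snd].
by apply: continuous_pair; exact: aux.
Qed.

(* If the line misses K, then K lies on one side of it, and any parallel line
   through a point of K does as well. *)
Lemma halved_touch K D u c : cvx K -> K !=set0 -> halved K D u c ->
  exists c', (exists2 p, K p & dot u p = c') /\ halved K D u c'.
Proof.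
move=> vK [p0 Kp0] hK.
have [[p Kp pc]|no] := pselect (exists2 p, K p & dot u p = c).
  by exists c; split => //; exists p.
exists (dot u p0); split; first by exists p0.
suff h x y : K x -> K y -> edist x y <= D by move=> x y Kx Ky; split => _ _; exact: h.
move=> Kx Ky.
have ne z : K z -> dot u z != c by move=> Kz; apply/eqP => e; apply: no; exists z.
have cross_line z w : K z -> K w -> dot u z < c -> c < dot u w -> False.
  move=> Kz Kw zc cw; apply: no.
  pose t := (c - dot u z) / (dot u w - dot u z).
  have d0 : 0 < dot u w - dot u z by lra.
  have t1 : 0 <= t <= 1 by rewrite /t divr_ge0 ?ler_pdivrMr//=; lra.
  exists ((1 - t) * z.1 + t * w.1, (1 - t) * z.2 + t * w.2); first exact: vK.
  transitivity (dot u z + t * (dot u w - dot u z)); first by rewrite /dot /=; ring.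
  by rewrite /t divfK ?lt0r_neq0//; lra.
have [h1 h2] := hK x y Kx Ky.
have [cx|cx|/eqP] := ltgtP (dot u x) c; last by rewrite (negbTE (ne x Kx)).
  have [cy|cy|/eqP] := ltgtP (dot u y) c; last by rewrite (negbTE (ne y Ky)).
    exact: h2.
  by case: (cross_line x y).
have [cy|cy|/eqP] := ltgtP (dot u y) c; last by rewrite (negbTE (ne y Ky)).
  by case: (cross_line y x).
exact: h1.
Qed.

Lemma shrink_le1 (d : R) : 0 <= d -> (forall e, 0 < e <= 1 -> (1 - e) ^+ 2 * d <= 1) ->
    d <= 1.
Proof.
move=> d0 h; rewrite leNgt; apply/negP => d1.
(* Chosen so that d - 2 e d = 1; the remaining term e^2 d then makes (1 - e)^2 d exceed 1. *)
pose e := (d - 1) / (2 * d).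
have de : e * d = (d - 1) / 2 by rewrite /e; field; lra.
have e0 : 0 < e by rewrite divr_gt0; lra.
have e1 : e <= 1 by rewrite ler_pdivrMr; lra.
have := h e; rewrite e0 e1 => /(_ isT).
have -> : (1 - e) ^+ 2 * d = d - 2 * (e * d) + e * (e * d) by ring.
rewrite de; have : 0 < e * ((d - 1) / 2) by rewrite mulr_gt0//; lra.
lra.
Qed.

Definition halved_axis K := forall x y, K x -> K y ->
  (0 < x.2 -> 0 < y.2 -> dist2 x y <= 1) /\ (x.2 < 0 -> y.2 < 0 -> dist2 x y <= 1).

(** Moved towards z by a fraction e, points of the axis come to the open side of z, where the bound
    holds. The distances concerned shrink exactly by the factor 1 - e, and e is arbitrary. *)
Lemma halved_axis_dist2 K p q z : cvx K -> halved_axis K -> K p -> K q -> K z ->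
  p.2 = 0 -> q.2 = 0 -> z.2 != 0 -> dist2 p z <= 1 /\ dist2 p q <= 1.
Proof.
move=> vK hK Kp Kq Kz p0 q0 z0.
pose pt w e : R * R := ((1 - e) * w.1 + e * z.1, (1 - e) * w.2 + e * z.2).
have Kpt w e : K w -> 0 < e <= 1 -> K (pt w e) by move=> Kw ee; apply: vK => //; lra.
have key w w' e : K w -> K w' -> w.2 = 0 -> w'.2 = 0 -> 0 < e <= 1 ->
    dist2 (pt w e) z <= 1 /\ dist2 (pt w e) (pt w' e) <= 1.
  move=> Kw Kw' w0 w0' ee.
  have [h1 h2] := hK _ _ (Kpt _ _ Kw ee) Kz.
  have [h3 h4] := hK _ _ (Kpt _ _ Kw ee) (Kpt _ _ Kw' ee).
  have e2 v : v.2 = 0 -> (pt v e).2 = e * z.2 by rewrite /pt /= => ->; rewrite mulr0 add0r.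
  rewrite !e2// in h1 h2 h3 h4.
  have [zn|zp|] := ltgtP z.2 0; last by move/eqP; rewrite (negbTE z0).
    have ez : e * z.2 < 0 by rewrite pmulr_rlt0//; lra.
    by split; [exact: h2|exact: h4].
  have ez : 0 < e * z.2 by rewrite pmulr_rgt0//; lra.
  by split; [exact: h1|exact: h3].
split; apply: shrink_le1; rewrite ?dist2_ge0// => e ee.
  have [h _] := key p q e Kp Kq p0 q0 ee; move: h; congr (_ <= _).
  by rewrite /dist2 /pt /=; ring.
have [_ h] := key p q e Kp Kq p0 q0 ee; move: h; congr (_ <= _).
by rewrite /dist2 /pt /=; ring.
Qed.

(** The translation centers the chord. For a point (x, y), [|x| + a] is then the horizontal distance
    to the farther end of the chord, so [nlens] is the distance bound to that end. *)
Lemma halved_axis_normalized K : closed K -> bounded2 K -> cvx K -> halved_axis K ->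
  (exists x, K (x, 0)) -> (exists2 z, K z & z.2 != 0) ->
  exists tau a, normalized (affine 1 0 tau 0 1 0 @^-1` K) a.
Proof.
move=> cK [M hM] vK hK [x0 Kx0] [z Kz z0].
pose S := [set x | K (x, 0)].
have cS : closed S.
  have := @closed_ysection R K 0 cK; congr closed.
  by apply/seteqP; split => x; rewrite /ysection /= inE.
have bS x : S x -> - M <= x <= M by move=> /hM [/= h _]; rewrite -ler_norml.
have hs : has_sup S by split; [exists x0|exists M => x /bS; lra].
have hi : has_inf S by split; [exists x0|exists (- M) => x /bS; lra].
have Ss : S (sup S) by apply: cS; exact: closure_sup hs.1 hs.2.
have sU := ub_le_sup hs.2; have iL := ge_inf hi.2.
have Si : S (inf S).
  apply: cS => B /nbhs_ballP[e /= e0 be]; have [r Sr rlt] := inf_adherent e0 hi.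
  exists r; split => //; apply: be; rewrite -ball_normE /= ltr_norml.
  by have := iL _ Sr; lra.
set al := inf S in Si iL; set be := sup S in Ss sU.
have albe : al <= be by apply: iL.
pose tau := (al + be) / 2; pose a := (be - al) / 2.
have [_ dab] := halved_axis_dist2 vK hK Ss Si Kz erefl erefl z0.
have ab1 : be - al <= 1.
  by move: dab; rewrite /dist2 /= subrr expr0n /= addr0; nra.
have KE x y : (affine 1 0 tau 0 1 0 @^-1` K) (x, y) = K (x + tau, y).
  by rewrite /affine /= !(mul1r, mul0r, addr0, add0r).
have nchord0 x : K (x + tau, 0) -> `|x| <= a.
  by move=> Kx; rewrite ler_norml /a; have := sU _ Kx; have := iL _ Kx; rewrite /tau; lra.
have lens x y : K (x + tau, y) -> (`|x| + a) ^+ 2 + y ^+ 2 <= 1.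
  move=> Kx; have [y0|y0] := eqVneq y 0.
    rewrite y0 in Kx *; have := nchord0 _ Kx; have := normr_ge0 x;
        rewrite /a expr0n /= addr0.
    move: (`|x|) => r r0 ra.
    by rewrite expr_le1//; lra.
  have [h1 _] := halved_axis_dist2 vK hK Ss Si Kx erefl erefl y0.
  have [h2 _] := halved_axis_dist2 vK hK Si Ss Kx erefl erefl y0.
  move: h1 h2; rewrite /dist2 /= !sub0r !sqrrN => h1 h2.
  have [xp|xp] := leP 0 x.
    by rewrite ger0_norm// (_ : x + a = - (al - (x + tau))) ?sqrrN// /tau /a; field.
  by rewrite ltr0_norm// (_ : - x + a = be - (x + tau))// /tau /a; field.
exists tau, a; split.
- by apply: preimage_closed => // w _; exact: continuous_affine.
- move=> p q t; case: p q => [p1 p2] [q1 q2]; rewrite !KE /= => Kp Kq tt.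
  by have := vK _ _ t Kp Kq tt; congr K; rewrite /=; congr pair; ring.
- rewrite /a; lra.
- move=> x y h; rewrite !KE => Kx Ky; have [h0|h0] := eqVneq h 0.
    rewrite h0 in Kx Ky; have := nchord0 _ Kx; have := nchord0 _ Ky.
    rewrite !ler_norml /a; lra.
  have [h1 h2] := hK _ _ Kx Ky.
  have : dist2 (x + tau, h) (y + tau, h) <= 1.
    have [hp|hn|] := ltgtP h 0; [exact: h2|exact: h1|by move/eqP; rewrite (negbTE h0)].
  by rewrite /dist2 /= subrr expr0n /= addr0; nra.
- by move=> x y; rewrite KE; exact: lens.
- by move=> x; rewrite KE; exact: nchord0.
Qed.

End normalization.

(** * Similarities *)

Section similarity.
Context {R : realType}.
Implicit Types (p q z w t u : R * R) (K F : set (R * R)) (c d D : R).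

(** For unit u and d = 1 or -1: dilation by c, reflection in the first axis if d = -1, rotation
    taking (1, 0) to u, translation by t. *)
Definition simil c u d t := affine (c * u.1) (- (c * d * u.2)) t.1 (c * u.2) (c * d *
    u.1) t.2.

Definition simil_inv c u d t := affine (u.1 / c) (u.2 / c) (- dot u t / c)
  (- (d * u.2) / c) (d * u.1 / c) (d * (u.2 * t.1 - u.1 * t.2) / c).

Section theory.
Variables (c d : R) (u t : R * R).
Hypotheses (c0 : 0 < c) (uu : dot u u = 1) (dd : d ^+ 2 = 1).

Let cn0 : c != 0. Proof. by rewrite lt0r_neq0. Qed.

Lemma similK : cancel (simil c u d t) (simil_inv c u d t).
Proof.
move=> [x y]; rewrite /simil /simil_inv /affine /=; congr pair.
- transitivity (dot u u * x); last by rewrite uu mul1r.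
  by rewrite /dot; field.
- transitivity (d ^+ 2 * dot u u * y); last by rewrite uu dd !mul1r.
  by rewrite /dot; field.
Qed.

Lemma simil_invK : cancel (simil_inv c u d t) (simil c u d t).
Proof.
move=> [x y]; rewrite /simil /simil_inv /affine /=; congr pair.
- transitivity (dot u u * x + (1 - dot u u) * t.1 +
    (d ^+ 2 - 1) * (u.2 ^+ 2 * (x - t.1) - u.1 * u.2 * (y - t.2))).
    by rewrite /dot; field.
  by rewrite uu dd; ring.
- transitivity (dot u u * y + (1 - dot u u) * t.2 +
    (d ^+ 2 - 1) * (u.1 ^+ 2 * (y - t.2) - u.1 * u.2 * (x - t.1))).
    by rewrite /dot; field.
  by rewrite uu dd; ring.
Qed.

Lemma dist2_simil p q : dist2 (simil c u d t p) (simil c u d t q) = c ^+ 2 * dist2 p q.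
Proof.
transitivity (c ^+ 2 * (dot u u * (p.1 - q.1) ^+ 2 + d ^+ 2 * dot u u * (p.2 - q.2) ^+ 2)).
  by rewrite /dist2 /simil /affine /dot /=; ring.
by rewrite uu dd !mul1r.
Qed.

Lemma mu2_simil K : measurable K ->
  mu2 (simil c u d t @^-1` K) = ((c ^- 2)%:E * mu2 K)%E.
Proof.
move=> mK.
have det : c * u.1 * (c * d * u.1) - - (c * d * u.2) * (c * u.2) = c ^+ 2 * d.
  by transitivity (c ^+ 2 * d * dot u u); [rewrite /dot; ring|rewrite uu mulr1].
have d1 : `|d| = 1.
  by apply/eqP; rewrite -(@pexpr_eq1 _ _ 2)// -normrX dd normr1.
rewrite mu2_affine// det ?normrM ?d1 ?mulr1 ?normrX ?(gtr0_norm c0)//.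
by rewrite mulf_neq0// ?expf_neq0// -normr_eq0 d1 oner_eq0.
Qed.

End theory.

(** By polarization f preserves inner products relative to the image of the origin. The unit vectors
    go to an orthonormal pair u, v, and every point keeps its coordinates in it. *)
Lemma rigid_simil (f : R * R -> R * R) : rigid_motion f ->
  exists u d t, [/\ dot u u = 1, d ^+ 2 = 1 & f =1 simil 1 u d t].
Proof.
move=> rf.
have d2 p q : dist2 (f p) (f q) = dist2 p q.
  have := rf p q; rewrite /Defs.edist -!/(dist2 _ _) => /(congr1 (fun x => x ^+ 2)).
  by rewrite !sqr_sqrtr ?dist2_ge0.
pose t := f (0, 0).
pose u : R * R := ((f (1, 0)).1 - t.1, (f (1, 0)).2 - t.2).
pose v : R * R := ((f (0, 1)).1 - t.1, (f (0, 1)).2 - t.2).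
have uu : dot u u = 1.
  have := d2 (1, 0) (0, 0); rewrite -/t {2}/dist2 /= !subr0 expr1n expr0n addr0 => <-.
  by rewrite /dot /dist2 /u /=; ring.
have vv : dot v v = 1.
  have := d2 (0, 1) (0, 0); rewrite -/t {2}/dist2 /= !subr0 expr1n expr0n add0r => <-.
  by rewrite /dot /dist2 /v /=; ring.
have uv : dot u v = 0.
  have := d2 (1, 0) (0, 1); rewrite {2}/dist2 /= subr0 sub0r sqrrN expr1n.
  have -> : dist2 (f (1, 0)) (f (0, 1)) = dot u u + dot v v - 2 * dot u v.
    by rewrite /dot /dist2 /u /v /=; ring.
  by rewrite uu vv; lra.
(* The sign d is the determinant of (u, v); Lagrange's identity gives its square. *)
exists u, (u.1 * v.2 - u.2 * v.1), t; split => //.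
  transitivity (dot u u * dot v v - dot u v ^+ 2); first by rewrite /dot; ring.
  by rewrite uu vv uv expr0n subr0 mulr1.
move=> z.
pose g : R * R := ((f z).1 - t.1, (f z).2 - t.2).
have gg : dot g g = z.1 ^+ 2 + z.2 ^+ 2.
  have := d2 z (0, 0); rewrite -/t {2}/dist2 /= !subr0 => <-.
  by rewrite /dot /dist2 /g /=; ring.
have gu : dot g u = z.1.
  have := d2 z (1, 0); rewrite {2}/dist2 /= subr0.
  have -> : dist2 (f z) (f (1, 0)) = dot g g + dot u u - 2 * dot g u.
    by rewrite /dot /dist2 /u /g /=; ring.
  by rewrite uu gg; lra.
have gv : dot g v = z.2.
  have := d2 z (0, 1); rewrite {2}/dist2 /= subr0.
  have -> : dist2 (f z) (f (0, 1)) = dot g g + dot v v - 2 * dot g v.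
    by rewrite /dot /dist2 /v /g /=; ring.
  by rewrite vv gg; lra.
have v1 : v.1 = - (u.1 * v.2 - u.2 * v.1) * u.2.
  transitivity (v.1 * dot u u - u.1 * dot u v); first by rewrite uu uv; ring.
  by rewrite /dot; ring.
have v2 : v.2 = (u.1 * v.2 - u.2 * v.1) * u.1.
  transitivity (v.2 * dot u u - u.2 * dot u v); first by rewrite uu uv; ring.
  by rewrite /dot; ring.
(* The squared distance from g to its expansion in u and v. *)
have : (g.1 - z.1 * u.1 - z.2 * v.1) ^+ 2 + (g.2 - z.1 * u.2 - z.2 * v.2) ^+ 2 = 0.
  transitivity (dot g g - 2 * z.1 * dot g u - 2 * z.2 * dot g v + z.1 ^+ 2 * dot u u
     + z.2 ^+ 2 * dot v v + 2 * z.1 * z.2 * dot u v); first by rewrite /dot; ring.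
  by rewrite gg gu gv uu vv uv; ring.
move/eqP; rewrite paddr_eq0 ?sqr_ge0// !sqrf_eq0 => /andP[/eqP g1 /eqP g2].
have fz : f z = (g.1 + t.1, g.2 + t.2) by rewrite /g /= !subrK; case: (f z).
rewrite fz /simil /affine !mul1r; congr pair.
  by move: g1; rewrite {1}v1; lra.
by move: g2; rewrite {1}v2; lra.
Qed.

Lemma simil_rigid u d t : dot u u = 1 -> d ^+ 2 = 1 -> rigid_motion (simil 1 u d t).
Proof.
move=> uu dd p q; rewrite /Defs.edist -!/(dist2 _ _) dist2_simil//.
by rewrite expr1n mul1r.
Qed.

Lemma simil_dilation c u d t w : simil c u d t w = simil 1 u d t (dilation c w).
Proof. by rewrite /simil /affine /dilation /=; congr pair; ring. Qed.

End similarity.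

(** * The extremal set *)

Section extremal_set.
Context {R : realType}.
Let a : R := halfwidth.

Lemma QsetP (x y : R) : Qset R (x, y) <->
  `|x| <= a /\ (`|x| + a) ^+ 2 + y ^+ 2 <= 1.
Proof.
rewrite /Qset /= -/(@halfwidth R) -/a ler_norml.
have a0 : 0 < a := @halfwidth_gt0 R.
split => [[xa q1 q2]|[xa q]]; split => //.
- by case: (ler0P x) => x0 //; rewrite (_ : (- x + a) ^+ 2 = (x - a) ^+ 2)//; ring.
- apply: le_trans q; rewrite lerD2r -subr_ge0.
  by have := ler_norm x => h; rewrite subr_sqr mulr_ge0//; lra.
- apply: le_trans q; rewrite lerD2r -subr_ge0.
  by have := ler_norm (- x); rewrite normrN => h; rewrite subr_sqr mulr_ge0//; lra.
Qed.

Lemma Qset_slice (x y : R) : Qset R (x, y) <-> `|x| <= Num.min a (csqrt y - a).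
Proof.
have a0 : 0 < a := @halfwidth_gt0 R.
rewrite QsetP le_min; split => [[-> h]|/andP[-> h]] /=.
  rewrite lerBrDr -[leLHS]ger0_norm; last by have := normr_ge0 x; lra.
  by rewrite -sqrtr_sqr; apply: ler_wsqrtr; lra.
split => //; have x0 := normr_ge0 x.
have s0 : 0 < csqrt y by lra.
have y1 : 0 < 1 - y ^+ 2 by move: s0; rewrite sqrtr_gt0.
have s2 : csqrt y ^+ 2 = 1 - y ^+ 2 by rewrite sqr_sqrtr// ltW.
rewrite -lerBrDr -s2 -subr_ge0 subr_sqr mulr_ge0//; lra.
Qed.

Lemma closed_Qset : closed (Qset R).
Proof.
have -> : Qset R = [set z | 0 <= a - `|z.1|] `&` [set z | 0 <= csqrt z.2 - a - `|z.1|].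
  apply/seteqP; split => -[x y]; rewrite Qset_slice /= !subr_ge0 le_min.
    by move=> /andP[].
  by move=> [-> ->].
have cn : continuous (fun z : R * R => `|z.1|).
  by move=> z; apply: cvg_norm; exact: cvg_fst.
apply: closedI.
  apply: (@preimage_closed _ _ (fun z : R * R => a - `|z.1|) [set x | 0 <= x]).
    by move=> z _; apply: cvgB; [exact: cvg_cst|exact: cn].
  exact: closed_ge.
apply: (@preimage_closed _ _ (fun z : R * R => csqrt z.2 - a - `|z.1|) [set x | 0 <= x]).
  move=> z _; apply: cvgB; last exact: cn.
  apply: cvgB; last exact: cvg_cst.
  by apply: (@continuous_comp _ _ _ snd (@csqrt R));
      [exact: cvg_snd|exact: continuous_csqrt].
exact: closed_ge.
Qed.

Lemma normalized_Qset : normalized (Qset R) a.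
Proof.
have ha := @halfwidth_bounds R; rewrite -/a in ha.
have conv (r s t : R) : 0 <= t <= 1 -> ((1 - t) * r + t * s) ^+ 2 <= (1 - t) * r ^+ 2 +
    t * s ^+ 2.
  move=> tt; rewrite -subr_ge0 (_ : _ - _ = t * (1 - t) * (r - s) ^+ 2); last by ring.
  by apply: mulr_ge0; [apply: mulr_ge0; lra|exact: sqr_ge0].
split.
- exact: closed_Qset.
- move=> [x y] [x' y'] t /QsetP[/= xa q] /QsetP[/= xa' q'] tt.
  have X : `|(1 - t) * x + t * x'| <= (1 - t) * `|x| + t * `|x'|.
    apply: (le_trans (ler_normD _ _)); rewrite !normrM.
    have t0 : 0 <= t by lra.
    have t1 : 0 <= 1 - t by lra.
    by rewrite (ger0_norm t0) (ger0_norm t1).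
  have tx : (1 - t) * `|x| <= (1 - t) * a by apply: ler_wpM2l => //; lra.
  have tx' : t * `|x'| <= t * a by apply: ler_wpM2l => //; lra.
  apply/QsetP; split; first lra.
  have h1 := conv (`|x| + a) (`|x'| + a) t tt; have h2 := conv y y' t tt.
  have h3 : (`|(1 - t) * x + t * x'| + a) ^+ 2 <= ((1 - t) * (`|x| + a) + t * (`|x'| +
      a)) ^+ 2.
    have := normr_ge0 ((1 - t) * x + t * x') => n0.
    by rewrite -subr_ge0 subr_sqr mulr_ge0//; lra.
  have h4 : (1 - t) * ((`|x| + a) ^+ 2 + y ^+ 2) <= (1 - t) * 1 by apply: ler_wpM2l =>
      //; lra.
  have h5 : t * ((`|x'| + a) ^+ 2 + y' ^+ 2) <= t * 1 by apply: ler_wpM2l => //; lra.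
  lra.
- lra.
- by move=> x y z /QsetP[+ _] /QsetP[+ _]; rewrite !ler_norml; lra.
- by move=> x y /QsetP[].
- by move=> x /QsetP[].
Qed.

(** The slices of Q have the extremal widths, so the estimate behind [mu2_big] is an equality at
    every height. *)
Lemma mu2_Qset : mu2 (Qset R) = (2 * atan (3 / 4))%:E.
Proof.
have ha := @halfwidth_bounds R; rewrite -/a in ha.
have nQ := normalized_Qset.
have mQ : measurable (Qset R) by apply: closed_measurable2; exact: closed_Qset.
have m y : mu (ysection (Qset R) y) = (2 * Num.max 0 (Num.min a (csqrt y - a)))%:E.
  set e := Num.min _ _.
  have -> : ysection (Qset R) y = `[- e, e]%classic.
    by apply/seteqP; split => x; rewrite /ysection /= inE in_itv /= Qset_slice ler_norml.
  rewrite lebesgue_measure_itv /= lte_fin.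
  have [e0|e0] := ltP (- e) e.
    by rewrite max_r; [rewrite -EFinB; congr EFin; ring|lra].
  by rewrite max_l ?mulr0//; lra.
have : (mu2 (Qset R) + mu2 (Qset R) + (4 * segment_area (2 * a))%:E = (4 * segment_area
    a)%:E)%E.
  rewrite (mu2_double nQ) -!integral_segment_width//; [|lra|lra].
  rewrite -ge0_integralD//; last 4 first.
  - by move=> y _; rewrite adde_ge0 ?measure_ge0.
  - apply: emeasurable_funD; first exact: measurable_fun_ysection.
    by apply: (measurableT_comp (measurable_fun_ysection (@lebesgue_measure R) mQ)).
  - by move=> y _; rewrite lee_fin mulr_ge0// segment_width_ge0.
  - exact: measurable_segment_widthM.
  apply: eq_integral => y _; rewrite !m csqrtN -!EFinD; congr EFin.
  rewrite /segment_width; move: (csqrt y) => s.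
  have [h1|h1] := leP a (s - a).
    rewrite [Num.max 0 a]max_r; last lra.
    by rewrite !max_r; lra.
  have [h2|h2] := leP 0 (s - a).
    by rewrite max_l; lra.
  by rewrite max_l; lra.
have := @band_area_halfwidth R; rewrite /band_area -/a.
have : (mu2 (Qset R) \is a fin_num).
  have big : (mu2 (Qset R) <= (2 * band_area a)%:E)%E by apply: (mu2_big nQ); lra.
  rewrite ge0_fin_numE ?measure_ge0//; exact: le_lt_trans big (ltry _).
move=> /fineK <-; move: (fine _) => r h; rewrite -!EFinD => -[] h'; congr EFin; lra.
Qed.

(** If p = (x, y) is the point farther from the axis, the differences of coordinates are at most |x|
    + a and |y|, so the lens condition at p alone suffices. *)
Lemma Qset_half_dist2 (e : R) p q : e = 1 \/ e = -1 -> Qset R p -> Qset R q ->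
  0 <= e * p.2 -> 0 <= e * q.2 -> dist2 p q <= 1.
Proof.
have ha := @halfwidth_bounds R; rewrite -/a in ha.
move=> ee; wlog : p q / e * q.2 <= e * p.2.
  move=> h Qp Qq p0 q0; have [le|/ltW le] := leP (e * q.2) (e * p.2); first exact: h.
  by have := h q p le Qq Qp q0 p0; congr (_ <= _); rewrite /dist2; ring.
case: p q => [x y] [x' y'] /= le /QsetP[xa q] /QsetP[xa' q'] p0 q0.
apply: le_trans q; rewrite /dist2 /=; apply: lerD.
  have h : `|x - x'| <= `|x| + a by apply: (le_trans (ler_normB _ _)); lra.
  by rewrite -real_normK ?num_real// -subr_ge0 subr_sqr mulr_ge0//;
      have := normr_ge0 (x - x'); have := normr_ge0 x; lra.
rewrite -subr_ge0 (_ : _ - _ = (e * y') * (2 * (e * y) - e * y') + (1 - e * e) * ((y -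
    y') ^+ 2 * -1 + y ^+ 2)); last by ring.
have -> : 1 - e * e = 0 by case: ee => ->; ring.
by rewrite mul0r addr0 mulr_ge0//; lra.
Qed.

End extremal_set.

(** * Area bound and converse *)

Section area_bound.
Context {R : realType}.
Implicit Types (p q z w t u : R * R) (K F : set (R * R)) (c d D : R).
Let C : R := 2 * atan (3 / 4).

Lemma continuous_simil c u d t : continuous (simil c u d t).
Proof. exact: continuous_affine. Qed.

Lemma continuous_simil_inv c u d t : continuous (simil_inv c u d t).
Proof. exact: continuous_affine. Qed.

Lemma coincide_simil K : coincide_up_to_dilation_and_rigid_motion K (Qset R) <->
  exists c u d t, [/\ 0 < c, dot u u = 1, d ^+ 2 = 1 & simil c u d t @^-1` K = Qset R].
Proof.
split=> [[c [f [c0 rf ->]]]|[c [u [d [t [c0 uu dd KQ]]]]]].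
  have [u [d [t [uu dd fE]]]] := rigid_simil rf.
  exists c, u, d, t; split => //; apply/seteqP; split => z /=.
    move=> [_ [w Qw <-]]; rewrite fE -simil_dilation.
    by move/(can_inj (similK _ c0 uu dd)) => <-.
  by move=> Qz; exists (dilation c z); [exists z|rewrite fE -simil_dilation].
exists c, (simil 1 u d t); split => //; first exact: simil_rigid.
apply/seteqP; split => z.
  move=> Kz; pose w := simil_inv c u d t z.
  have zw : simil c u d t w = z by exact: simil_invK.
  exists (dilation c w); last by rewrite -simil_dilation.
  by exists w => //; rewrite -KQ /= zw.
by move=> [_ [w Qw <-] <-]; rewrite -simil_dilation; rewrite -KQ in Qw.
Qed.

Lemma mu2_similar_Qset K c u d t : measurable K -> 0 < c -> dot u u = 1 -> d ^+ 2 = 1 ->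
  simil c u d t @^-1` K = Qset R -> mu2 K = (C * c ^+ 2)%:E.
Proof.
move=> mK c0 uu dd KQ; have := mu2_simil t c0 uu dd mK.
rewrite KQ mu2_Qset -/C => e.
have : ((c ^+ 2)%:E * C%:E = (c ^+ 2)%:E * ((c ^- 2)%:E * mu2 K))%E by rewrite -e.
rewrite muleA -!EFinM mulfV ?mul1e; last by rewrite expf_neq0// lt0r_neq0.
by move=> <-; rewrite mulrC.
Qed.

(* The bisection along the symmetry axis y = 0 of Q. *)
Lemma similar_Qset_bisection K c u d t : closed K -> bounded2 K ->
  0 < c -> dot u u = 1 -> d ^+ 2 = 1 ->
  simil c u d t @^-1` K = Qset R ->
  exists2 B, bisection K B & Num.max (diam B.1) (diam B.2) <= c.
Proof.
move=> cK bK c0 uu dd KQ.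
pose G := simil c u d t; pose H := simil_inv c u d t.
have GK : cancel G H by exact: similK.
have HK : cancel H G by exact: simil_invK.
have cH : continuous H by exact: continuous_simil_inv.
have cG : continuous G by exact: continuous_simil.
have KE z : K z <-> Qset R (H z).
  by rewrite -KQ /= -/(G _) HK.
have dG p q : dist2 (G p) (G q) = c ^+ 2 * dist2 p q by exact: dist2_simil.
clearbody H; clearbody G.
pose a : R := halfwidth.
have ha : 2 / 5 < a < 1 / 2 := halfwidth_bounds.
have ha2 : a ^+ 2 = 1 / 5 := halfwidth_sqr.
pose half (e : R) := K `&` [set z | 0 <= e * (H z).2].
have chalf e : closed (half e).
  apply: closedI => //.
  apply: (@preimage_closed _ _ (fun z => e * (H z).2) [set x | 0 <= x]);
      last exact: closed_ge.
  move=> z _; apply: cvgM; first exact: cvg_cst.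
  by apply: (@continuous_comp _ _ _ H snd); [exact: cH|exact: cvg_snd].
pose l (r : R) := G (a * r, 0).
have Hl r : H (l r) = (a * r, 0) by rewrite /l GK.
have Ql (r : R) : -1 <= r <= 1 -> Qset R (a * r, 0).
  move=> rr; apply/QsetP; have : `|a * r| <= a.
    rewrite normrM ger0_norm; last lra.
    by rewrite -[leRHS]mulr1 ler_wpM2l ?ler_norml//; lra.
  move=> h; split => //; rewrite expr0n /= addr0.
  have : (`|a * r| + a) ^+ 2 <= (a + a) ^+ 2.
    by rewrite -subr_ge0 subr_sqr mulr_ge0//; have := normr_ge0 (a * r); lra.
  by rewrite -/a; lra.
have diam_half e : e = 1 \/ e = -1 -> diam (half e) <= c.
  move=> ee; apply: ge_sup.
    have Gh : half e (l 0).
      by split; [apply/KE; rewrite Hl; apply: Ql; lra|rewrite /= Hl /= mulr0].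
    by exists (edist (l 0) (l 0)); exists (l 0) => //; exists (l 0).
  move=> _ [z [Kz z0] [w [Kw w0] <-]].
  rewrite euclid_le; last exact: ltW.
  rewrite -(HK z) -(HK w) dG ler_piMr ?sqr_ge0//.
  by apply: (@Qset_half_dist2 _ e); rewrite -?KE.
exists (half 1, half (-1)); last by rewrite /= ge_max !diam_half//; [right|left].
split => /=; try exact: chalf.
  apply/seteqP; split => z; last by case=> -[].
  move=> Kz; have [h|h] := leP 0 (H z).2; [left|right]; split => //=.
    by rewrite mul1r.
  by rewrite mulN1r oppr_ge0 ltW.
have KcE : closure K = K by apply/esym/closure_id.
have lim e : e = 1 \/ e = -1 -> ~ K° (l e).
  move=> ee; have e1 : `|e| = 1 by case: ee => ->; rewrite ?normrN1 ?normr1.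
  (* An interior end point would allow a small step outwards along the axis, which leaves Q. *)
  rewrite /l => /(@cG (a * e, 0)) /nbhs_ballP[r /= r0 br].
  have /KE : K (G (a * e + e * (r / 2), 0)).
    apply: br; split; rewrite /= -ball_normE /=; last by rewrite subrr normr0.
    rewrite opprD addrA subrr sub0r normrN normrM.
    by rewrite e1 mul1r gtr0_norm; lra.
  rewrite GK => /QsetP[+ _]; rewrite -/a.
  have -> : a * e + e * (r / 2) = e * (a + r / 2) by ring.
  by rewrite normrM e1 mul1r ger0_norm; lra.
exists l; split; last first.
  apply/seteqP; split => z.
    move=> [[Kz /= h1] [_ /= h2]].
    have z2 : (H z).2 = 0 by lra.
    have Qz := (KE z).1 Kz.
    have Hz : H z = ((H z).1, 0) by rewrite -z2; case: (H z).
    rewrite Hz in Qz; have [xa _] := (QsetP _ _).1 Qz.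
    exists ((H z).1 / a).
      by rewrite /= in_itv /= ler_pdivlMr ?ler_pdivrMr; [move: xa;
          rewrite -/a ler_norml; lra|lra|lra].
    rewrite /l -[RHS]HK Hz /=; congr (G (_, _)); field; lra.
  move=> [r /=]; rewrite in_itv /= => rr <-.
  by split; (split; [apply/KE; rewrite Hl; exact: Ql|rewrite /= Hl /= mulr0]).
split.
- have cp : continuous (fun r : R => (a * r, 0 : R)).
    have h1 : continuous (fun r : R => a * r).
      by move=> s; apply: cvgM; [exact: cvg_cst|exact: cvg_id].
    have h2 : continuous (fun _ : R => 0 : R) by move=> s; exact: cvg_cst.
    exact: (continuous_pair h1 h2).
  have cl : continuous l.
    by move=> r; apply: (@continuous_comp _ _ _ (fun r : R => (a * r, 0 : R)) G);
        [exact: cp|exact: cG].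
  exact: (continuous_subspaceT cl).
- move=> r s _ _ /(can_inj GK) [] /mulfI; apply; lra.
- by move=> z [r /=]; rewrite in_itv /= => rr <-; apply/KE; rewrite Hl; exact: Ql.
apply/seteqP; split => z.
  move=> [[r /=]]; rewrite in_itv /= => rr <- [_ nint].
  have [->|r1] := eqVneq r 1; first by right.
  have [->|r2] := eqVneq r (-1); first by left.
  exfalso; apply: nint.
  have {}rr : -1 < r < 1 by rewrite !lt_neqAle r1 eq_sym r2; lra.
  (* The strict inequalities of Q define an open set, which contains the open chord because (2 a)^2
     = 4/5 < 1. *)
  pose V := [set w : R * R | 0 < a - `|w.1|] `&`
            [set w : R * R | 0 < 1 - ((`|w.1| + a) * (`|w.1| + a) + w.2 * w.2)].
  have opn (f : R * R -> R) : continuous f -> open [set s | 0 < f s].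
    move=> cf; apply: (@open_comp _ _ f [set x | 0 < x]); last exact: open_gt.
    by move=> x _; exact: cf.
  have cn : continuous (fun w : R * R => `|w.1|).
    by move=> w; apply: cvg_norm; exact: cvg_fst.
  have ca : continuous (fun w : R * R => `|w.1| + a).
    by move=> w; apply: cvgD; [exact: cn|exact: cvg_cst].
  have oV : open V.
    apply: openI; apply: opn => w; apply: cvgB; try exact: cvg_cst; first exact: cn.
    by apply: cvgD; apply: cvgM; [exact: ca|exact: ca|exact: cvg_snd|exact: cvg_snd].
  have nV : nbhs (H (l r)) V.
    apply: open_nbhs_nbhs; split => //; rewrite Hl.
    have ar : `|a * r| < a.
      rewrite normrM ger0_norm; last lra.
      by rewrite -[ltRHS]mulr1 ltr_pM2l ?ltr_norml//; lra.
    split; rewrite /= subr_gt0// mulr0 addr0.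
    have := normr_ge0 (a * r) => n0.
    have : (`|a * r| + a) * (`|a * r| + a) <= (a + a) * (a + a) by apply: ler_pM; lra.
    by move: ha2; rewrite expr2; lra.
  have {}nV : nbhs (l r) (H @^-1` V) by exact: cH nV.
  apply: filterS nV => w [/= v1 v2]; apply/KE; case: (H w) v1 v2 => x y /= v1 v2.
  by apply/QsetP; rewrite -/a !expr2; split; lra.
have mem e : e = 1 \/ e = -1 -> ((l @` `[-1, 1]) `&` boundary K) (l e).
  move=> ee; split.
    by exists e => //=; rewrite in_itv /=; case: ee => ->; lra.
  split; last exact: lim.
  by rewrite KcE; apply/KE; rewrite Hl; apply: Ql; case: ee => ->; lra.
by case=> ->; apply: mem; [right|left].
Qed.

(** Any D > 0 is allowed, not just [DB K]: the converse applies this at a different scale to exclude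
    [DB K = 0]. *)
Lemma halved_area K D u c : convex_body K -> dot u u = 1 -> 0 < D -> halved K D u c ->
  (mu2 K <= (C * D ^+ 2)%:E)%E /\
  (mu2 K = (C * D ^+ 2)%:E -> coincide_up_to_dilation_and_rigid_motion K (Qset R)).
Proof.
move=> [compK convK intK] uu D0 hK0.
have cK : closed K by apply: compact_closed => //; exact: norm_hausdorff.
have bK : bounded2 K := compact_bounded2 compK.
have vK := convex_set_cvx convK.
have [w0 Kw0] := intK.
have Kne : K !=set0 by exists w0; exact: interior_subset.
have {c hK0}[c [[p Kp pc] hK]] := halved_touch vK Kne hK0.
(* The similarity with direction v takes the second axis to the direction u, and its translation
   [t0] puts the first axis on the dividing line. *)
pose v : R * R := (u.2, - u.1).
have vv : dot v v = 1 by rewrite -uu /dot /v /=; ring.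
have dd : (1 : R) ^+ 2 = 1 by rewrite expr1n.
pose t0 : R * R := (c * u.1, c * u.2).
pose G := simil D v 1 t0; pose H := simil_inv D v 1 t0.
have GK : cancel G H by exact: similK.
have HK : cancel H G by exact: simil_invK.
have dotG z : dot u (G z) = D * z.2 + c.
  transitivity (D * z.2 * dot u u + c * dot u u); last by rewrite uu !mulr1.
  by rewrite /dot /G /simil /affine /v /t0 /=; ring.
pose K0 := G @^-1` K.
have cK0 : closed K0 by apply: preimage_closed => // z _; exact: continuous_simil.
have bK0 : bounded2 K0.
  have [M hM] := bK.
  exists ((`|v.1 / D| + `|v.2 / D|) * M + `|- dot v t0 / D| +
     ((`|- (1 * v.2) / D| + `|1 * v.1 / D|) * M + `|1 * (v.2 * t0.1 - v.1 * t0.2) / D|)).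
  move=> z Kz; have [z1 z2] := hM _ Kz; rewrite -(GK z); move: (G z) z1 z2 => w z1 z2.
  have M0 : 0 <= M by exact: le_trans z1.
  have aux (b e f : R) : `|b * w.1 + e * w.2 + f| <= (`|b| + `|e|) * M + `|f|.
    apply: (le_trans (ler_normD _ _)); rewrite lerD2r; apply: (le_trans (ler_normD _ _)).
    by rewrite !normrM mulrDl; apply: lerD; apply: ler_wpM2l.
  have pos (b e f : R) : 0 <= (`|b| + `|e|) * M + `|f|.
    by rewrite addr_ge0// mulr_ge0// addr_ge0.
  by split; rewrite /H /simil_inv /affine; cbn [fst snd]; apply: (le_trans (aux _ _ _));
    rewrite ?lerDl ?lerDr; exact: pos.
clearbody H.
have vK0 : cvx K0.
  move=> z w r Kz Kw rr; have := vK _ _ r Kz Kw rr; rewrite /K0 /=; congr K.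
  by rewrite /G /simil /affine /=; congr pair; ring.
have hK0 : halved_axis K0.
  have sc z w : K0 z -> K0 w -> edist (G z) (G w) <= D -> dist2 z w <= 1.
    move=> _ _; rewrite euclid_le; last exact: ltW.
    by rewrite dist2_simil// ger_pMr// exprn_gt0.
  move=> z w Kz Kw; have [h1 h2] := hK _ _ Kz Kw; rewrite !dotG in h1 h2.
  have sgp r : (c < D * r + c) = (0 < r) by rewrite -subr_gt0 addrK pmulr_rgt0.
  have sgn r : (D * r + c < c) = (r < 0) by rewrite -subr_gt0 opprD addrCA subrr addr0
      oppr_gt0 pmulr_rlt0.
  rewrite !sgp !sgn in h1 h2.
  by split=> z0 w0'; apply: sc => //; [exact: h1|exact: h2].
have touch : exists x : R, K0 (x, 0).
  have e : (H p).2 = 0.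
    by have := dotG (H p); rewrite HK pc => /eqP;
        rewrite -subr_eq0 opprD addrCA subrr addr0 oppr_eq0 mulf_eq0 (gt_eqF D0) /= => /eqP.
  have Hp : H p = ((H p).1, 0) by rewrite -e; case: (H p).
  by exists (H p).1; rewrite -Hp /K0 /preimage /mkset HK.
have off : exists2 z, K0 z & z.2 != 0.
  have off' z : K z -> dot u z != c -> exists2 z, K0 z & z.2 != 0.
    move=> Kz zc; exists (H z); first by rewrite /K0 /preimage /mkset HK.
    by apply: contra zc => /eqP e; rewrite -(HK z) dotG e mulr0 add0r.
  have [e|] := eqVneq (dot u w0) c; last by apply: off'; exact: interior_subset.
  have ray0 : ray w0 u 0 = w0 by rewrite /ray !mul0r !addr0; case: (w0).
  have : nbhs (ray w0 u 0) K by rewrite ray0.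
  move/(@continuous_ray _ w0 u 0) => /nbhs_ballP[r /= r0 br].
  apply: (off' (ray w0 u (r / 2))).
    by apply: br; rewrite -ball_normE /= sub0r normrN gtr0_norm; lra.
  have -> : dot u (ray w0 u (r / 2)) = c + r / 2.
    rewrite -e -[r / 2 in RHS]mulr1 -uu /dot /ray /=; ring.
  by rewrite -subr_eq0 addrAC subrr add0r; lra.
have [tau [a nK]] := halved_axis_normalized cK0 bK0 vK0 hK0 touch off.
pose t : R * R := (D * v.1 * tau + t0.1, D * v.2 * tau + t0.2).
have nKE : affine 1 0 tau 0 1 0 @^-1` K0 = simil D v 1 t @^-1` K.
  apply/seteqP; split => z; rewrite /K0 /= /G /simil /affine /t /=;
  (congr K; congr pair; ring).
rewrite nKE in nK.
have mK : measurable K by exact: closed_measurable2.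
have areaE := mu2_simil t D0 vv dd mK.
set K1 := simil D v 1 t @^-1` K in nK areaE.
have KE : (mu2 K = (D ^+ 2)%:E * mu2 K1)%E.
  by rewrite areaE muleA -EFinM mulfV ?mul1e// expf_neq0// lt0r_neq0.
have a0 := na nK.
(* Except at a = [halfwidth] the bound is strict, which rules out equality. *)
have bound : (mu2 K1 <= C%:E)%E /\ (mu2 K1 = C%:E -> K1 = Qset R).
  have [a4|a4] := leP a (1 / 4).
    have h := mu2_small nK a4; have C1 : 1 < C by rewrite /C; have := @atan34_gt R; lra.
    split; first by apply: (le_trans h); rewrite lee_fin ltW.
    by move=> e; move: h; rewrite e lee_fin leNgt C1.
  have h := mu2_big nK (ltW a4).
  have [ah|ah] := eqVneq a halfwidth.
    rewrite ah in nK h; split; first by rewrite /C -band_area_halfwidth.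
    exact: normalized_extremal nK.
  have lt : 2 * band_area a < C by rewrite /C ltr_pM2l// band_area_lt//; lra.
  split; first by apply: (le_trans h); rewrite lee_fin ltW.
  by move=> e; move: h; rewrite e lee_fin leNgt lt.
have [b1 b2] := bound.
split.
  by rewrite KE (mulrC C) (EFinM (D ^+ 2) C) lee_wpmul2l// lee_fin sqr_ge0.
move=> e; apply/coincide_simil; exists D, v, 1, t; split => //.
apply: b2; rewrite areaE e -EFinM mulrC; congr EFin.
by rewrite -mulrA mulfV ?mulr1// expf_neq0// lt0r_neq0.
Qed.

End area_bound.

Theorem theorem1p2 (R : realType) (K : set (R * R)) (hK : convex_body K) :
  area K / DB K ^+ 2 <= 2 * atan (3 / 4) /\
  (area K / DB K ^+ 2 = 2 * atan (3 / 4) <->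
   coincide_up_to_dilation_and_rigid_motion K (Qset R)).
Proof.
have [compK _ _] := hK.
have cK : closed K by apply: compact_closed => //; exact: norm_hausdorff.
have mK : measurable K by exact: closed_measurable2.
have bK : bounded2 K := compact_bounded2 compK.
set C : R := 2 * atan (3 / 4).
have C0 : 0 < C by rewrite /C; have := @atan34_gt R; lra.
pose V := [set Num.max (diam B.1) (diam B.2) | B in bisection K].
have V0 : lbound V 0 by move=> _ [B _ <-]; rewrite le_max diam_ge0.
have DB0 : 0 <= DB K.
  rewrite /DB -/V; have [->|/set0P Vne] := eqVneq V set0; first by rewrite inf0.
  exact: lb_le_inf.
have areaE : area K = fine (mu2 K) by [].
have le_real D : (mu2 K <= (C * D ^+ 2)%:E)%E -> area K <= C * D ^+ 2.
  move=> h; rewrite areaE -lee_fin fineK// ge0_fin_numE ?measure_ge0//.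
  exact: le_lt_trans h (ltry _).
(* [fine] sends infinite values to 0, so a nonzero value is the true measure. *)
have mu2E r : area K = r -> r != 0 -> mu2 K = r%:E.
  by rewrite areaE; case: (mu2 K) => [s /= ->|/= <-|/= <-] //; rewrite eqxx.
have upper : bisection K !=set0 -> 0 < DB K ->
    (mu2 K <= (C * DB K ^+ 2)%:E)%E /\
    (mu2 K = (C * DB K ^+ 2)%:E -> coincide_up_to_dilation_and_rigid_motion K (Qset R)).
  by move=> bne D0; have [u [c [uu h]]] := DB_halved hK bne;
      exact: (halved_area hK uu D0 h).
have converse : coincide_up_to_dilation_and_rigid_motion K (Qset R) ->
    area K / DB K ^+ 2 = C.
  move=> /coincide_simil[c [u [d [t [c0 uu dd KQ]]]]].
  have muK := mu2_similar_Qset mK c0 uu dd KQ.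
  have [B hB hc] := similar_Qset_bisection cK bK c0 uu dd KQ.
  have bne : bisection K !=set0 by exists B.
  have DBc : DB K <= c.
    apply: le_trans hc; apply: ge_inf; last by exists B.
    by exists 0.
  (* Otherwise K would be halved with bound c / 2, and its area C c^2 would be at most C c^2 / 4. *)
  have [D0|D0] := leP (DB K) 0.
    have [v [e [vv he]]] := DB_halved hK bne.
    have c2 : 0 < c / 2 by lra.
    have hle : DB K <= c / 2 by lra.
    have [+ _] := halved_area hK vv c2 (halved_le hle he).
    rewrite muK lee_fin ler_pM2l// => h; exfalso.
    by have c22 : 0 < c ^+ 2 := exprn_gt0 2 c0; move: h; rewrite expr_div_n; lra.
  (* The area bound gives c <= [DB K]; the bisection along the axis gave the reverse. *)
  have [+ _] := upper bne D0.
  rewrite muK lee_fin ler_pM2l// ler_pXn2r ?nnegrE//; last exact: ltW.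
  move=> cD; have -> : DB K = c by apply/eqP; rewrite eq_le DBc.
  by rewrite areaE muK /= mulfK// expf_neq0// lt0r_neq0.
(* In particular when K has no bisection: [inf set0 = 0] and [x / 0 = 0]. *)
have [D0|Dn0] := eqVneq (DB K) 0.
  have ratio0 : area K / DB K ^+ 2 = 0 by rewrite D0 expr0n invr0 mulr0.
  split; first by rewrite ratio0 ltW.
  by split; [rewrite ratio0 => e; move: C0; rewrite -e ltxx|exact: converse].
have D0 : 0 < DB K by rewrite lt_neqAle eq_sym Dn0.
have D2 : 0 < DB K ^+ 2 by rewrite exprn_gt0.
have bne : bisection K !=set0.
  apply/set0P; apply: contra Dn0 => /eqP b0.
  by rewrite /DB b0 image_set0 inf0.
have [h1 h2] := upper bne D0.
split; first by rewrite ler_pdivrMr//; exact: le_real.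
split; last exact: converse.
move=> e; apply: h2; apply: mu2E.
  by rewrite -e divfK// lt0r_neq0.
by rewrite mulf_neq0 ?lt0r_neq0.
Qed.
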